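(* Let $M$ be a compact Riemannian manifold without boundary and let $X_t$ be a time-dependent vector field on $M$, $t\in[0,T)$. Assume that there are a (time-dependent) non-negative function $b_t:M\to\mathbb{R}$, a time-dependent vector field $Y_t$ on $M$, a (time-dependent) fibre-preserving bundle homomorphism $W_t:TM\to TM$, and constants $k_2,k_3\in\mathbb{R}$ such that: 1. for each $t$, $w\mapsto\langle X_t,w\rangle$ is a closed $1$-form; 2. $W_t+\mathrm{Rm}(\cdot,X_t)X_t\ge k_3 I$; 3. for each $t$, each $x\in M$, and each eigenvector $v\in T_xM$ of the linear map $w\mapsto\nabla_wX_t$ on $T_xM$ belonging to its largest eigenvalue, $$\langle\nabla_v(\dot X_t+\nabla X_t(X_t)),v\rangle+k_2\langle\nabla X_t(\nabla X_t(v)),v\rangle+\langle W_tv,v\rangle\le b_t\langle\Delta\nabla X_t(v),v\rangle+\langle\nabla_{Y_t}\nabla_vX_t,v\rangle;$$ 4. $1+k_2>0$. Then, for all $t\in(0,T)$, $$\nabla X_t\le\frac{1}{1+k_2}\,a_{(1+k_2)k_3}(t)\,I ,$$ where $$a_K(t)=\begin{cases}\sqrt K\cot(\sqrt K\,t)&\text{if }K>0,\\ \frac1t&\text{if }K=0,\\ \sqrt{-K}\coth(\sqrt{-K}\,t)&\text{if }K<0.\end{cases}$$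
   Context: All data are smooth in $(t,x)$. $\nabla X_t$ denotes the endomorphism $w\mapsto\nabla_wX_t$ of $TM$ (self-adjoint because of condition 1), so $\nabla X_t(X_t)=\nabla_{X_t}X_t$. Inequalities such as $A\ge cI$ between endomorphisms of $T_xM$ mean $\langle Av,v\rangle\ge c|v|^2$ for all $v\in T_xM$. $\mathrm{Rm}$ is the Riemann curvature tensor, with the sign convention that the trace of $v\mapsto\mathrm{Rm}(v,X)X$ is $\mathrm{Ric}(X,X)$. $\Delta\nabla X_t$ is the rough (connection) Laplacian of the endomorphism field $\nabla X_t$, and $\nabla_{Y_t}\nabla_vX_t$ means $(\nabla_{Y_t}(\nabla X_t))(v)$, i.e. the covariant derivative of the endomorphism field $\nabla X_t$ along $Y_t$ applied to $v$. A dot denotes the derivative in $t$. *)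

(* Defs.v *)
From HB Require Import structures.
From mathcomp Require Import all_boot all_order all_algebra.
From mathcomp Require Import all_classical all_reals all_analysis.

Set Implicit Arguments.
Unset Strict Implicit.
Unset Printing Implicit Defensive.

Import Order.TTheory GRing.Theory Num.Theory.
Import numFieldNormedType.Exports.

Local Open Scope classical_set_scope.
Local Open Scope ring_scope.

(* Meant for open U in a finite-dimensional E, where asking for the derivatives
   in all directions amounts to asking for the partial derivatives. *)
Fixpoint Ck (R : realType) (E F : normedModType R) (k : nat) (U : set E)
    (f : E -> F) : Prop :=
  (forall x, U x -> {for x, continuous f}) /\
  match k with
  | 0%N => True
  | k'.+1 => forall v : E,
      (forall x, U x -> derivable f x v) /\ Ck k' U (fun x => 'D_v f x)
  end.

Definition smooth (R : realType) (E F : normedModType R) (U : set E)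
    (f : E -> F) : Prop := forall k, Ck k U f.

Definition time_in (R : realType) (T : \bar R) (t : R) : Prop :=
  0 <= t /\ (t%:E < T)%E.

(* Smoothness in (t, x) on [0, T) x U, up to the boundary t = 0: locally, f is
   the restriction of a smooth function on an open subset of R x R^n. *)
Definition tsmooth (R : realType) (n : nat) (F : normedModType R)
    (T : \bar R) (U : set 'rV[R]_n) (f : R -> 'rV[R]_n -> F) : Prop :=
  forall t x, time_in T t -> U x ->
  exists (V : set (R^o * 'rV[R]_n)%type) (G : (R^o * 'rV[R]_n)%type -> F),
    [/\ open V, V (t, x), smooth V G &
        forall s y, time_in T s -> U y -> V (s, y) -> f s y = G (s, y)].

(* The right-hand derivative: for data that are smooth on [0, T) this is the
   derivative at t > 0 and the one-sided derivative at t = 0. *)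
Definition dot (R : realType) (F : normedModType R) (f : R -> F) (t : R) : F :=
  lim ((h^-1 *: (f (t + h) - f t)) @[h --> (0 : R)^'+]).

Record chart (R : realType) (n : nat) (M : topologicalType) := Chart {
  cdom : set M;
  chart_coord : M -> 'rV[R]_n;
  chart_param : 'rV[R]_n -> M;
  cdom_open : open cdom;
  ccodom_open : open (chart_coord @` cdom);
  chart_coordK : forall x, cdom x -> chart_param (chart_coord x) = x;
  chart_coord_continuous : forall x, cdom x -> {for x, continuous chart_coord};
  chart_param_continuous : forall y, (chart_coord @` cdom) y -> {for y, continuous chart_param}
}.

Definition ccodom (R : realType) (n : nat) (M : topologicalType)
  (c : chart R n M) : set 'rV[R]_n := chart_coord c @` cdom c.

Definition transition (R : realType) (n : nat) (M : topologicalType)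
  (c d : chart R n M) (y : 'rV[R]_n) : 'rV[R]_n := chart_coord d (chart_param c y).

Record manifold (R : realType) (n : nat) := Manifold {
  points :> topologicalType;
  chart_index : Type;
  atlas : chart_index -> chart R n points;
  points_hausdorff : hausdorff_space points;
  points_second_countable : @second_countable points;
  atlas_cover : forall x : points, exists i, cdom (atlas i) x;
  atlas_smooth : forall i j,
    smooth (chart_coord (atlas i) @` (cdom (atlas i) `&` cdom (atlas j)))
           (transition (atlas i) (atlas j))
}.

(* Tangent vectors and tensor fields are given by their components in each
   chart of the atlas; the differential of the transition map from chart i to
   chart j relates the components.  Components are row vectors, and an
   endomorphism A of a tangent space acts by v |-> v *m A. *)

Definition is_vfield (R : realType) (n : nat) (M : manifold R n)
    (X : chart_index M -> 'rV[R]_n -> 'rV[R]_n) : Prop :=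
  forall (i j : chart_index M) (x : M), cdom (atlas i) x -> cdom (atlas j) x ->
    X j (chart_coord (atlas j) x) =
    'D_(X i (chart_coord (atlas i) x)) (transition (atlas i) (atlas j))
       (chart_coord (atlas i) x).

Definition is_endo (R : realType) (n : nat) (M : manifold R n)
    (A : chart_index M -> 'rV[R]_n -> 'M[R]_n) : Prop :=
  forall (i j : chart_index M) (x : M), cdom (atlas i) x -> cdom (atlas j) x ->
  forall v : 'rV[R]_n,
    'D_v (transition (atlas i) (atlas j)) (chart_coord (atlas i) x)
      *m A j (chart_coord (atlas j) x) =
    'D_(v *m A i (chart_coord (atlas i) x)) (transition (atlas i) (atlas j))
      (chart_coord (atlas i) x).

Definition ip (R : realType) (n : nat) (G : 'M[R]_n) (v w : 'rV[R]_n) : R :=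
  (v *m G *m w^T) 0 0.

Record riemannian (R : realType) (n : nat) := Riemannian {
  mfd :> manifold R n;
  metric : chart_index mfd -> 'rV[R]_n -> 'M[R]_n;
  metric_smooth : forall i, smooth (ccodom (atlas i)) (metric i);
  metric_sym : forall i y, ccodom (atlas i) y -> (metric i y)^T = metric i y;
  metric_pos : forall i y, ccodom (atlas i) y ->
    forall v : 'rV[R]_n, v != 0 -> 0 < ip (metric i y) v v;
  metric_compat : forall (i j : chart_index mfd) (x : mfd),
    cdom (atlas i) x -> cdom (atlas j) x ->
    forall v w : 'rV[R]_n,
      ip (metric j (chart_coord (atlas j) x))
        ('D_v (transition (atlas i) (atlas j)) (chart_coord (atlas i) x))
        ('D_w (transition (atlas i) (atlas j)) (chart_coord (atlas i) x)) =
      ip (metric i (chart_coord (atlas i) x)) v w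
}.

Definition basis_vec (R : realType) (n : nat) (i : 'I_n) : 'rV[R]_n :=
  delta_mx 0 i.

(* Gamma^k_ij = 1/2 g^kl (d_i g_jl + d_j g_il - d_l g_ij) *)
Definition christoffel (R : realType) (n : nat) (g : 'rV[R]_n -> 'M[R]_n)
    (y : 'rV[R]_n) (k i j : 'I_n) : R :=
  2^-1 * \sum_(l < n) invmx (g y) k l *
    ('D_(basis_vec R i) (fun z => g z j l : R^o) y +
     'D_(basis_vec R j) (fun z => g z i l : R^o) y -
     'D_(basis_vec R l) (fun z => g z i j : R^o) y).

(* Levi-Civita derivative nabla_u Z of a vector field Z, for u tangent at y *)
Definition cov (R : realType) (n : nat) (g : 'rV[R]_n -> 'M[R]_n)
    (u : 'rV[R]_n) (Z : 'rV[R]_n -> 'rV[R]_n) (y : 'rV[R]_n) : 'rV[R]_n :=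
  'D_u Z y +
  \row_k \sum_(i < n) \sum_(j < n) christoffel g y k i j * u 0 i * Z y 0 j.

Definition nabla (R : realType) (n : nat) (g : 'rV[R]_n -> 'M[R]_n)
    (Z : 'rV[R]_n -> 'rV[R]_n) (y : 'rV[R]_n) : 'M[R]_n :=
  \matrix_(i < n) cov g (basis_vec R i) Z y.

(* Rm(u,v)w = nabla_u nabla_v w - nabla_v nabla_u w - nabla_[u,v] w, where u, v
   and w are extended with constant components, so that [u,v] = 0.  With this
   sign the trace of v |-> Rm(v,w)w is Ric(w,w). *)
Definition Rm (R : realType) (n : nat) (g : 'rV[R]_n -> 'M[R]_n)
    (y u v w : 'rV[R]_n) : 'rV[R]_n :=
  cov g u (fun z => cov g v (cst w) z) y - cov g v (fun z => cov g u (cst w) z) y.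

(* nabla_u A for an endomorphism field A, determined by the Leibniz rule
   (nabla_u A)(w) = nabla_u (A w) - A (nabla_u w) with w = basis_vec i. *)
Definition cov_endo (R : realType) (n : nat) (g : 'rV[R]_n -> 'M[R]_n)
    (u : 'rV[R]_n) (A : 'rV[R]_n -> 'M[R]_n) (y : 'rV[R]_n) : 'M[R]_n :=
  \matrix_(i < n)
    (cov g u (fun z => basis_vec R i *m A z) y -
     cov g u (cst (basis_vec R i)) y *m A y).

(* nabla^2_{u,v} A = nabla_u (nabla_v A) - nabla_{nabla_u v} A *)
Definition hess_endo (R : realType) (n : nat) (g : 'rV[R]_n -> 'M[R]_n)
    (u v : 'rV[R]_n) (A : 'rV[R]_n -> 'M[R]_n) (y : 'rV[R]_n) : 'M[R]_n :=
  cov_endo g u (fun z => cov_endo g v A z) y - cov_endo g (cov g u (cst v) y) A y.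

Definition rough_laplacian (R : realType) (n : nat) (g : 'rV[R]_n -> 'M[R]_n)
    (A : 'rV[R]_n -> 'M[R]_n) (y : 'rV[R]_n) : 'M[R]_n :=
  \sum_(i < n) \sum_(j < n)
    invmx (g y) i j *: hess_endo g (basis_vec R i) (basis_vec R j) A y.

(* d omega = 0 on U, for the 1-form omega = <X, .> *)
Definition dual_form_closed (R : realType) (n : nat) (g : 'rV[R]_n -> 'M[R]_n)
    (U : set 'rV[R]_n) (X : 'rV[R]_n -> 'rV[R]_n) : Prop :=
  forall y, U y -> forall u w : 'rV[R]_n,
    'D_u (fun z => ip (g z) (X z) w : R^o) y =
    'D_w (fun z => ip (g z) (X z) u : R^o) y.

Definition top_eigenvector (R : realType) (n : nat) (A : 'M[R]_n)
    (v : 'rV[R]_n) : Prop :=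
  v != 0 /\ exists lambda : R,
    v *m A = lambda *: v /\ (forall mu, eigenvalue A mu -> mu <= lambda).

Definition cot (R : realType) (s : R) : R := cos s / sin s.

Definition coth (R : realType) (s : R) : R :=
  (expR s + expR (- s)) / (expR s - expR (- s)).

Definition comparison (R : realType) (K t : R) : R :=
  if 0 < K then Num.sqrt K * cot (Num.sqrt K * t)
  else if K == 0 then t^-1
  else Num.sqrt (- K) * coth (Num.sqrt (- K) * t).

(* Main.v *)
(* Hamilton's maximum principle for the endomorphism field [nabla X_t], whose
   largest eigenvalue is followed through the Rayleigh quotient
   q(t, x, v) = <nabla_v X_t, v> / <v, v>.  At a spatial maximum of q the vector
   v is a top eigenvector, (nabla_u nabla X)(v, v) = 0 for all u, and
   (Delta nabla X)(v, v) <= 0.  Since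
   nabla_v (nabla X (X)) = Rm(v, X) X + nabla X (nabla X v) + (nabla_X nabla X) v,
   the hypotheses give dq/dt <= - k3 - (1 + k2) q^2 there.

   Let s'' = - K s with K = (1 + k2) k3, s(0) = 0, s'(0) = 1, so that the
   comparison function is s' / s.  For u = (1 + k2) q the quantity
   h = s u - s' is -1 at t = 0 and satisfies h' <= - u h at spatial maxima, so a
   positive maximum of exp(- L t) h over [0, t1] x SM is impossible as soon as
   L > - u.  Hence s u <= s' as long as s >= 0; for K > 0 this cannot hold at the
   first zero of s, where s' = -1, so the solution does not live that long. *)

Require Import Defs.
From HB Require Import structures.
From mathcomp Require Import all_boot all_order all_algebra.
From mathcomp Require Import all_classical all_reals all_analysis.
From mathcomp Require Import ring lra.
Import Order.TTheory GRing.Theory Num.Theory.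
Import numFieldNormedType.Exports.
Local Open Scope classical_set_scope.
Local Open Scope ring_scope.

Set Implicit Arguments.
Unset Strict Implicit.

(** * Functions of class C^k *)

(** The metric does not depend on time, so at a space-time maximum both the chart and the components
    of [v] can be frozen. The time derivative is then taken along fixed components, and the spatial
    conditions are computed in that single chart. Hence only the Rayleigh quotient has to be
    compared between charts; the curvature, the Laplacian and the other tensors never are. The
    product [s u] replaces the more obvious difference between [u] and [s' / s] because the latter
    blows up at [t = 0]: with the product, the initial comparison is a finite number and needs no
    control of [u] near [0]. The inequality [h' <= - u h] alone does not suffice, since [u] has no
    known sign; the exponential weight makes the derivative at a positive maximum strictly negative.
    A suitable [L] exists because [u] is bounded below on [[0, t1] x SM], by the same extreme value
    argument applied to [- u]. The contradiction uses only earlier times, so the maximum may also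
    sit at [t1]. *)

Section Ck_generic.
Context {R : realType} {E F : normedModType R}.
Implicit Types (U V : set E) (f g : E -> F).

(** Openness of [U] turns equality on [U] into equality near each of its points, which is what
    limits and derivatives see. *)
Lemma Ck_eq U k f g : open U -> (forall x, U x -> f x = g x) ->
  Ck k U f -> Ck k U g.
Proof.
move=> oU; elim: k f g => [|k IH] f g fg [fc fd].
  split=> // x Ux.
  have xfg : \near x, f x = g x by apply: filterS (open_nbhs_nbhs (conj oU Ux)).
  rewrite /prop_for /continuous_at -(fg _ Ux).
  exact: cvg_trans (near_eq_cvg xfg) (fc _ Ux).
have nfg x : U x -> \near x, f x = g x.
  by move=> Ux; apply: filterS (open_nbhs_nbhs (conj oU Ux)).
split=> [x Ux|v].
  rewrite /prop_for /continuous_at -(fg _ Ux).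
  exact: cvg_trans (near_eq_cvg (nfg _ Ux)) (fc _ Ux).
have [fdv fk] := fd v; split=> [x Ux|].
  exact: near_eq_derivable (nfg _ Ux) (fdv _ Ux).
apply: IH fk => x Ux; exact: near_eq_derive (nfg _ Ux).
Qed.

Lemma Ck_sub U V k f : V `<=` U -> Ck k U f -> Ck k V f.
Proof.
move=> VU; elim: k f => [|k IH] f [fc fd]; first by split=> // x /VU /fc.
by split=> [x /VU /fc //|v]; have [fv fk] := fd v; split=> [x /VU /fv //|]; apply: IH.
Qed.

Lemma CkS U k f : Ck k.+1 U f -> Ck k U f.
Proof.
elim: k f => [|k IH] f [fc fd]; first by split.
by split=> // v; have [fv fk] := fd v; split=> //; apply: IH.
Qed.

Lemma Ck_local U k f :
  (forall x, U x -> exists V, V x /\ Ck k V f) -> Ck k U f.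
Proof.
elim: k f => [|k IH] f Uf.
  by split=> // x /Uf [V [Vx [+ _]]]; apply.
split=> [x /Uf [V [Vx [+ _]]]|v]; first by apply.
split=> [x /Uf [V [Vx [_ /(_ v) [+ _]]]]|]; first by apply.
by apply: IH => x /Uf [V [Vx [_ /(_ v) [_ fk]]]]; exists V.
Qed.

Lemma Ck_cst U k (c : F) : Ck k U (fun=> c).
Proof.
elim: k c => [|k IH] c; first by split=> // x _; exact: cst_continuous.
split=> [x _|v]; first exact: cst_continuous.
split=> [x _|]; first exact: derivable_cst.
have -> : (fun x : E => 'D_v (fun=> c) x) = (fun=> 0).
  by apply/funext => x; rewrite derive_cst.
exact: IH.
Qed.

Lemma CkD U k f g : open U -> Ck k U f -> Ck k U g -> Ck k U (fun x => f x + g x).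
Proof.
move=> oU; elim: k f g => [|k IH] f g [fc fd] [gc gd].
  by split=> // x Ux; apply: continuousD; [apply: fc|apply: gc].
split=> [x Ux|v]; first by apply: continuousD; [apply: fc|apply: gc].
have [fv fk] := fd v; have [gv gk] := gd v; split=> [x Ux|].
  by apply: derivableD; [apply: fv|apply: gv].
apply: (@Ck_eq _ _ (fun x => 'D_v f x + 'D_v g x)) => //; last exact: IH.
by move=> x Ux; rewrite deriveD//; [apply: fv|apply: gv].
Qed.

Lemma CkZ U k (c : R) f : open U -> Ck k U f -> Ck k U (fun x => c *: f x).
Proof.
move=> oU; elim: k f => [|k IH] f [fc fd].
  by split=> // x Ux; apply: continuousZr; apply: fc.
split=> [x Ux|v]; first by apply: continuousZr; apply: fc.
have [fv fk] := fd v; split=> [x Ux|]; first by apply: derivableZ; apply: fv.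
apply: (@Ck_eq _ _ (fun x => c *: 'D_v f x)) => //; last exact: IH.
by move=> x Ux; rewrite deriveZ//; apply: fv.
Qed.

End Ck_generic.

Section Ck_real.
Context {R : realType} {E : normedModType R}.
Implicit Types (U V : set E) (f g : E -> R^o).

Lemma CkM U k f g : open U -> Ck k U f -> Ck k U g ->
  Ck k U (fun x => f x * g x : R^o).
Proof.
move=> oU; elim: k f g => [|k IH] f g fk gk; have [fc fd] := fk; have [gc gd] := gk.
  by split=> // x Ux; apply: continuousM; [apply: fc|apply: gc].
split=> [x Ux|v]; first by apply: continuousM; [apply: fc|apply: gc].
have [fv fvk] := fd v; have [gv gvk] := gd v; split=> [x Ux|].
  by apply: (@derivableM _ _ f g); [apply: fv|apply: gv].
apply: (@Ck_eq _ _ _ _ _ (fun x => f x * 'D_v g x + g x * 'D_v f x : R^o)) => //.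
  by move=> x Ux; rewrite (@deriveM _ _ f g)//; [apply: fv|apply: gv].
by apply: CkD => //; apply: IH => //; apply: CkS.
Qed.

Lemma CkV U k f : open U -> (forall x, U x -> f x != 0) -> Ck k U f ->
  Ck k U (fun x => (f x)^-1 : R^o).
Proof.
move=> oU f0; elim: k => [|k IH] fk; have [fc fd] := fk.
  by split=> // x Ux; apply: (@cvgV _ _ _ _ f); [exact: f0|exact: fc].
split=> [x Ux|v]; first by apply: (@cvgV _ _ _ _ f); [exact: f0|exact: fc].
have [fv fvk] := fd v; split=> [x Ux|].
  by apply: (@derivableV _ _ f); [exact: f0|exact: fv].
apply: (@Ck_eq _ _ _ _ _ (fun x => (- 1 : R) *: ((f x)^-1 * (f x)^-1 * 'D_v f x) : R^o)) => //.
  move=> x Ux; rewrite (@deriveV _ _ f)//; [|exact: f0|exact: fv].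
  by rewrite scaleN1r scaleNr -expr2 exprVn.
apply: CkZ => //; apply: CkM => //; apply: CkM => //; apply: IH; exact: CkS.
Qed.

Lemma Ck_sum (F : normedModType R) (I : Type) (r : seq I) (P : pred I) U k (f : I -> E -> F) :
  open U -> (forall i, P i -> Ck k U (f i)) ->
  Ck k U (fun x => \sum_(i <- r | P i) f i x).
Proof.
move=> oU fk; elim: r => [|i r IH].
  by apply: (@Ck_eq _ _ _ _ _ (fun=> 0)) (@Ck_cst _ _ _ _ _ _) => // x _; rewrite big_nil.
have [Pi|NPi] := boolP (P i).
  apply: (@Ck_eq _ _ _ _ _ (fun x => f i x + \sum_(i <- r | P i) f i x)) => //.
    by move=> x _; rewrite big_cons Pi.
  by apply: CkD => //; exact: fk.
apply: Ck_eq IH => // x _; by rewrite big_cons (negbTE NPi).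
Qed.

Lemma Ck_prod (I : Type) (r : seq I) (P : pred I) U k (f : I -> E -> R^o) :
  open U -> (forall i, P i -> Ck k U (f i)) ->
  Ck k U (fun x => \prod_(i <- r | P i) f i x : R^o).
Proof.
move=> oU fk; elim: r => [|i r IH].
  by apply: (@Ck_eq _ _ _ _ _ (fun=> 1 : R^o)) (@Ck_cst _ _ _ _ _ _) => // x _; rewrite big_nil.
have [Pi|NPi] := boolP (P i).
  apply: (@Ck_eq _ _ _ _ _ (fun x => f i x * \prod_(i <- r | P i) f i x : R^o)) => //.
    by move=> x _; rewrite big_cons Pi.
  by apply: CkM => //; exact: fk.
apply: Ck_eq IH => // x _; by rewrite big_cons (negbTE NPi).
Qed.

Lemma cvg_mxP (m n : nat) (T : Type) (F : set_system T) (FF : Filter F)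
    (f : T -> 'M[R]_(m, n)) (l : 'M[R]_(m, n)) :
  f x @[x --> F] --> l <-> forall i j, f x i j @[x --> F] --> (l i j : R).
Proof.
split=> [fl i j|fl].
  apply: (@cvg_comp _ _ _ f (fun M : 'M[R]_(m, n) => M i j) F (nbhs l)) => //.
  exact: coord_continuous.
apply/cvgrPdist_le => e e0; near=> x.
rewrite [leLHS]/Num.Def.normr/= mx_normrE (bigmax_le _ (ltW e0))//= => -[i j] _.
rewrite !mxE/=; move: (i) (j); near: x.
apply: filter_forall => i0; apply: filter_forall => j0.
exact: ((cvgrPdist_le _ _).1 (fl i0 j0)).
Unshelve. all: by end_near. Qed.

Lemma Ck_mxP (m n : nat) U k (f : E -> 'M[R]_(m, n)) : open U ->
  Ck k U f <-> forall i j, Ck k U (fun x => f x i j : R^o).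
Proof.
move=> oU; elim: k f => [|k IH] f; split.
- by move=> [fc _] i j; split=> // x Ux; have /cvg_mxP := fc x Ux; apply.
- by move=> fk; split=> // x Ux; apply/cvg_mxP => i j; have [fc _] := fk i j; apply: fc.
- move=> [fc fd] i j; split=> [x Ux|v]; first by have /cvg_mxP := fc x Ux; apply.
  have [fv fvk] := fd v; split=> [x Ux|].
    by have /derivable_mxP := fv x Ux; apply.
  move/IH : fvk => /(_ i j); apply: Ck_eq => // x Ux.
  by rewrite derive_mx ?mxE//; exact: fv.
- move=> fk; split=> [x Ux|v].
    by apply/cvg_mxP => i j; have [fc _] := fk i j; apply: fc.
  have fv x : U x -> derivable f x v.
    by move=> Ux; apply/derivable_mxP => i j; have [_ /(_ v)[+ _]] := fk i j; apply.
  split=> //; apply/IH => i j; have [_ /(_ v) [_]] := fk i j.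
  apply: Ck_eq => // x Ux; by rewrite derive_mx ?mxE//; exact: fv.
Qed.

End Ck_real.

Section smooth_generic.
Context {R : realType} {E F : normedModType R}.
Implicit Types (U V : set E) (f g : E -> F).

Lemma smooth_eq U f g : open U -> (forall x, U x -> f x = g x) ->
  smooth U f -> smooth U g.
Proof. by move=> oU fg sf k; exact: Ck_eq (sf k). Qed.

Lemma smooth_continuous U f x : smooth U f -> U x -> {for x, continuous f}.
Proof. by move=> /(_ 0%N) [+ _]; apply. Qed.

Lemma smooth_derivable U f x v : smooth U f -> U x -> derivable f x v.
Proof. by move=> /(_ 1%N) [_ /(_ v) [+ _]]; apply. Qed.

Lemma smooth_is_derive U f x v : smooth U f -> U x -> is_derive x v f ('D_v f x).
Proof. by move=> sf Ux; apply/derivableP/smooth_derivable; [exact: sf|]. Qed.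

Lemma smooth_derive U f v : smooth U f -> smooth U ('D_v f).
Proof. by move=> sf k; have [_ /(_ v) []] := sf k.+1. Qed.

Lemma smooth_cst U (c : F) : smooth U (fun=> c).
Proof. by move=> k; exact: Ck_cst. Qed.

Lemma smoothD U f g : open U -> smooth U f -> smooth U g ->
  smooth U (fun x => f x + g x).
Proof. by move=> oU sf sg k; exact: CkD. Qed.

Lemma smoothZ U (c : R) f : open U -> smooth U f -> smooth U (fun x => c *: f x).
Proof. by move=> oU sf k; exact: CkZ. Qed.

Lemma smoothB U f g : open U -> smooth U f -> smooth U g ->
  smooth U (fun x => f x - g x).
Proof.
move=> oU sf sg; apply: (@smooth_eq _ (fun x => f x + (-1 : R) *: g x)) => //.
  by move=> x _; rewrite scaleN1r.
by apply: smoothD => //; exact: smoothZ.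
Qed.

Lemma smooth_sum (I : Type) (r : seq I) (P : pred I) U (f : I -> E -> F) :
  open U -> (forall i, P i -> smooth U (f i)) ->
  smooth U (fun x => \sum_(i <- r | P i) f i x).
Proof. by move=> oU sf k; apply: Ck_sum => // i /sf. Qed.

End smooth_generic.

Section smooth_mx.
Context {R : realType} {E : normedModType R}.
Implicit Types (U V : set E).

Lemma smoothM U (f g : E -> R^o) : open U -> smooth U f -> smooth U g ->
  smooth U (fun x => f x * g x : R^o).
Proof. by move=> oU sf sg k; exact: CkM. Qed.

Lemma smoothV U (f : E -> R^o) : open U -> (forall x, U x -> f x != 0) ->
  smooth U f -> smooth U (fun x => (f x)^-1 : R^o).
Proof. by move=> oU f0 sf k; exact: CkV. Qed.

Lemma smooth_prod (I : Type) (r : seq I) (P : pred I) U (f : I -> E -> R^o) :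
  open U -> (forall i, P i -> smooth U (f i)) ->
  smooth U (fun x => \prod_(i <- r | P i) f i x : R^o).
Proof. by move=> oU sf k; apply: Ck_prod => // i /sf. Qed.

Lemma smooth_mxP (m n : nat) U (f : E -> 'M[R]_(m, n)) : open U ->
  smooth U f <-> forall i j, smooth U (fun x => f x i j : R^o).
Proof.
by move=> oU; split=> [sf i j k|sf k]; [have /Ck_mxP := sf k; apply|
  apply/Ck_mxP => // i j; exact: sf].
Qed.

Lemma smooth_mulmx (m n p : nat) U (f : E -> 'M[R]_(m, n)) (g : E -> 'M[R]_(n, p)) :
  open U -> smooth U f -> smooth U g -> smooth U (fun x => f x *m g x).
Proof.
move=> oU /(smooth_mxP _ oU) sf /(smooth_mxP _ oU) sg; apply/smooth_mxP => // i j.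
apply: (@smooth_eq _ _ _ _ (fun x => \sum_k f x i k * g x k j : R^o)) => //.
  by move=> x _; rewrite mxE.
by apply: smooth_sum => // k _; exact: smoothM.
Qed.

Lemma smooth_trmx (m n : nat) U (f : E -> 'M[R]_(m, n)) :
  open U -> smooth U f -> smooth U (fun x => (f x)^T).
Proof.
move=> oU /(smooth_mxP _ oU) sf; apply/smooth_mxP => // i j.
by apply: smooth_eq (sf j i) => // x _; rewrite mxE.
Qed.

Lemma smooth_det (n : nat) U (f : E -> 'M[R]_n) :
  open U -> smooth U f -> smooth U (fun x => \det (f x) : R^o).
Proof.
move=> oU /(smooth_mxP _ oU) sf; rewrite /determinant.
apply: smooth_sum => // s _; apply: smoothM => //; first exact: smooth_cst.
by apply: smooth_prod => // i _; exact: sf.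
Qed.

(** By the adjugate formula the entries of the inverse are quotients of polynomials in the entries,
    with the determinant as denominator. *)
Lemma smooth_invmx (n : nat) U (f : E -> 'M[R]_n) : open U ->
  (forall x, U x -> f x \in unitmx) -> smooth U f ->
  smooth U (fun x => invmx (f x)).
Proof.
move=> oU fu sf; apply: (@smooth_eq _ _ _ _ (fun x => (\det (f x))^-1 *: \adj (f x))) => //.
  by move=> x Ux; rewrite /invmx fu.
apply/smooth_mxP => // i j.
apply: (@smooth_eq _ _ _ _ (fun x => (\det (f x))^-1 * cofactor (f x) j i : R^o)) => //.
  by move=> x _; rewrite !mxE.
apply: smoothM => //.
  apply: smoothV => //; first by move=> x /fu; rewrite unitmxE unitfE.
  exact: smooth_det.
rewrite /cofactor; apply: smoothM => //; first exact: smooth_cst.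
apply: smooth_det => //; move/(smooth_mxP _ oU) : sf => sf.
apply/smooth_mxP => // k l.
by apply: smooth_eq (sf (lift j k) (lift i l)) => // x _; rewrite !mxE.
Qed.

Lemma is_derive_mulmx (m n p : nat) (f : E -> 'M[R]_(m, n)) (g : E -> 'M[R]_(n, p))
    (x v : E) df dg :
  is_derive x v f df -> is_derive x v g dg ->
  is_derive x v (fun x => f x *m g x) (df *m g x + f x *m dg).
Proof.
move=> [fd <-] [gd <-].
have fd' i j : is_derive x v (fun x => f x i j) ('D_v (fun x => f x i j) x).
  by apply/derivableP; have /derivable_mxP := fd; apply.
have gd' i j : is_derive x v (fun x => g x i j) ('D_v (fun x => g x i j) x).
  by apply/derivableP; have /derivable_mxP := gd; apply.
have D i j : is_derive x v (fun x => (f x *m g x) i j)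
   (('D_v f x *m g x + f x *m 'D_v g x) i j).
  rewrite (_ : (fun x => _) = \sum_k ((fun x => f x i k) * (fun x => g x k j))).
    apply: is_derive_eq.
    rewrite !mxE -big_split/=; apply: eq_bigr => k _.
    rewrite (derive_mx fd) (derive_mx gd) !mxE addrC; congr (_ + _).
    exact: mulrC.
  by apply/funext => y; rewrite fct_sumE mxE.
have dfg : derivable (fun x => f x *m g x) x v.
  by apply/derivable_mxP => i j; have [] := D i j.
split=> //; rewrite derive_mx//; apply/matrixP => i j; rewrite mxE.
by have [_ ->] := D i j.
Qed.

Lemma is_derive_trmx (m n : nat) (f : E -> 'M[R]_(m, n)) (x v : E) df :
  is_derive x v f df -> is_derive x v (fun x => (f x)^T) df^T.
Proof.
have fT i j : (fun y => (f y)^T i j) = (fun y => f y j i).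
  by apply/funext => y; rewrite mxE.
move=> [fd <-].
have dfT : derivable (fun x => (f x)^T) x v.
  by apply/derivable_mxP => i j; rewrite fT; have /derivable_mxP := fd; apply.
split=> //; rewrite derive_mx// (derive_mx fd); apply/matrixP => i j.
by rewrite [LHS]mxE [RHS]mxE [RHS]mxE fT.
Qed.

Lemma is_derive_mx (m n : nat) (f : E -> 'M[R]_(m, n)) (x v : E) df :
  is_derive x v f df <-> forall i j, is_derive x v (fun x => f x i j) (df i j).
Proof.
split=> [[fd <-] i j|fd].
  split; first by have /derivable_mxP := fd; apply.
  by rewrite derive_mx// mxE.
have fdv : derivable f x v by apply/derivable_mxP => i j; have [] := fd i j.
split=> //; rewrite derive_mx//; apply/matrixP => i j; rewrite mxE.
by have [_ ->] := fd i j.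
Qed.

End smooth_mx.

(** * Mean values and mixed derivatives *)

Lemma is_derive_line (R : realType) (E F : normedModType R) (f : E -> F) (x v : E) (s : R) :
  derivable f (s *: v + x) v ->
  is_derive s (1 : R) (fun t : R => f (t *: v + x)) ('D_v f (s *: v + x)).
Proof.
have eqf : (fun h : R => h^-1 *: (((fun t : R => f (t *: v + x)) \o shift s) (h *: (1 : R))
     - f (s *: v + x))) =
   (fun h : R => h^-1 *: ((f \o shift (s *: v + x)) (h *: v) - f (s *: v + x))).
  by apply/funext => h /=; rewrite [_%:A]mulr1 scalerDl addrA.
by move=> fd; split; rewrite /derivable /derive/= eqf.
Qed.

Lemma near_ball_scale (R : realType) (E : normedModType R) (P : set E) (x : E) : (\near x, P x) ->
  exists2 d : R, 0 < d & forall w : E, `|w| < d -> P (w + x).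
Proof.
move=> /nbhs_ballP[d d0 dP]; exists d => // w wd; apply: dP.
by rewrite -ball_normE/= opprD addrCA subrr addr0 normrN.
Qed.

Section mean_value.
Context {R : realType} {E : normedModType R}.
Implicit Types (U : set E) (f : E -> R).

Lemma is_derive_line_scale f x v (h s : R) : derivable f ((h * s) *: v + x) v ->
  is_derive s (1:R) (fun t : R => f ((h * t) *: v + x)) (h * 'D_v f ((h * s) *: v + x)).
Proof.
move=> fs; pose k (s : R) : R := h * s; pose l (t : R) := f (t *: v + x).
have [fd1 fd2] : is_derive (k s) (1:R) l ('D_v f (k s *: v + x)).
  exact: is_derive_line.
have [hd1 hd2] : is_derive s (1:R) k h.
  have := @is_deriveZ R _ _ (@id R) h s 1 1 (is_derive_id _ _).
  by rewrite [h *: 1]mulr1.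
split.
  apply/derivable1_diffP/(@differentiable_comp _ _ _ _ k l).
    exact/derivable1_diffP.
  exact/derivable1_diffP.
by rewrite -derive1E (derive1_comp hd1 fd1) !derive1E hd2 fd2 mulrC.
Qed.

Lemma MVT_line_oo f x v (h : R) :
  (forall s : R, 0 <= s <= 1 -> derivable f (s *: (h *: v) + x) v) ->
  exists2 s : R, 0 < s < 1 & f (h *: v + x) - f x = h * 'D_v f (s *: (h *: v) + x).
Proof.
move=> fd; pose g (s : R) := f ((h * s) *: v + x).
have gd (s : R) : 0 <= s <= 1 -> is_derive s (1:R) g (h * 'D_v f (s *: (h *: v) + x)).
  by move=> /fd; rewrite scalerA mulrC => /is_derive_line_scale.
have [||s s01] := @MVT R g (fun s => h * 'D_v f (s *: (h *: v) + x)) 0 1 ltr01.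
- by move=> s; rewrite in_itv/= => /andP[s0 s1]; apply: gd; rewrite !ltW.
- apply: derivable_within_continuous => s; rewrite in_itv/= => s01.
  by have [] := gd s s01.
rewrite /g/= mulr1 mulr0 scale0r add0r subr0 mulr1 => ->.
by exists s => //; move: s01; rewrite in_itv.
Qed.

Lemma MVT_line f x v (h : R) :
  (forall s : R, 0 <= s <= 1 -> derivable f (s *: (h *: v) + x) v) ->
  exists2 s : R, 0 <= s <= 1 & f (h *: v + x) - f x = h * 'D_v f (s *: (h *: v) + x).
Proof.
by move=> /MVT_line_oo[s /andP[s0 s1] sE]; exists s => //; rewrite !ltW.
Qed.

Lemma open_line U x (v : E) : open U -> U x ->
  \forall h \near (0 : R), forall s : R, 0 <= s <= 1 -> U (s *: (h *: v) + x).
Proof.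
move=> oU Ux.
have [d d0 dU] := near_ball_scale (open_nbhs_nbhs (conj oU Ux)).
near=> h => s /andP[s0 s1]; apply: dU.
rewrite normrZ ger0_norm// (le_lt_trans (ler_piMl _ s1))// normrZ.
(* The factor [|v| + 1] in place of [|v|] keeps the later division legitimate when [v = 0]. *)
rewrite (@le_lt_trans _ _ (`|h| * (`|v| + 1)))// ?ler_wpM2l ?lerDl//.
rewrite -ltr_pdivlMr ?ltr_wpDl//; near: h.
move: (d / (`|v| + 1)) (divr_gt0 d0 (ltr_wpDl (normr_ge0 v) (@ltr01 R))) => e e0.
exact: (@nbhs0_lt _ R^o).
Unshelve. all: by end_near. Qed.

(** The base point of the quotient moves with [h]; after the mean value theorem, continuity of
    ['D_v f] at [x] absorbs the motion. In [deriveD_dir] this treats the second leg of the path from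
    [x] through [h *: u + x] to [h *: (u + v) + x]. *)
Lemma cvg_quotient_curve U f x v (c : R -> E) : open U -> U x -> Ck 1 U f ->
  c h @[h --> (0 : R)] --> x ->
  h^-1 * (f (h *: v + c h) - f (c h)) @[h --> (0 : R)^'] --> 'D_v f x.
Proof.
move=> oU Ux [fc fd] cx; have [fv [fvc _]] := fd v.
apply/cvgrPdist_le => e e0.
have [d d0 dP] : exists2 d : R, 0 < d & forall w : E, `|w| < d ->
    U (w + x) /\ `|'D_v f x - 'D_v f (w + x)| <= e.
  apply: (@near_ball_scale _ _ [set y | U y /\ `|'D_v f x - 'D_v f y| <= e]).
  apply: filterI; first exact: open_nbhs_nbhs.
  exact: ((cvgrPdist_le _ _).1 (fvc x Ux) _ e0).
have [r r0 rP] : exists2 r : R, 0 < r & forall h : R, `|h| < r ->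
    (forall s : R, 0 <= s <= 1 -> `|s *: (h *: v)| < d / 2) /\ `|c h - x| < d / 2.
  have := @near_ball_scale R R^o [set h : R | (forall s : R, 0 <= s <= 1 ->
     `|s *: (h *: v)| < d / 2) /\ `|c h - x| < d / 2] 0.
  move=> /(_ _)[|r r0 rP]; last first.
    by exists r => // h /rP; rewrite /= addr0.
  have d20 : 0 < d / 2 by rewrite divr_gt0.
  apply: filterI; last first.
    have /cvgrPdist_lt/(_ _ d20) := cx.
    by apply: filterS => h; rewrite distrC.
  have oB : open (ball (0 : E) (d / 2)) by exact: ball_open.
  have /(open_line v oB) : ball (0 : E) (d / 2) 0 by exact: ballxx.
  apply: filterS => h hP s /hP; by rewrite -ball_normE/= addr0 sub0r normrN.
near=> h.
have hr : `|h| < r by near: h; apply: dnbhs0_lt.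
have h0 : h != 0 by near: h; exact: nbhs_dnbhs_neq.
have [hv cv] := rP h hr.
have dv s : 0 <= s <= 1 -> `|s *: (h *: v) + (c h - x)| < d.
  move=> s01; apply: le_lt_trans (ler_normD _ _) _.
  by rewrite (splitr d) ltrD// hv.
have [s s01|s s01 ->] := @MVT_line f (c h) v h.
  apply: fv; have [+ _] := dP _ (dv s s01); by rewrite -addrA subrK.
rewrite mulKf//; have [_] := dP _ (dv s s01); by rewrite -addrA subrK.
Unshelve. all: by end_near. Qed.

(** Directional derivatives need not be additive in the direction in general; here the increment is
    split into two legs and continuity of the derivatives is used on the second. *)
Lemma deriveD_dir U f x u v : open U -> U x -> Ck 1 U f ->
  'D_(u + v) f x = 'D_u f x + 'D_v f x.
Proof.
move=> oU Ux f1; apply: cvg_lim => //.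
have cu : h *: u + x @[h --> (0 : R)] --> x.
  rewrite -[X in _ --> X]add0r -(scale0r u).
  by apply: cvgD; [apply: cvgZr_tmp; exact: cvg_id|exact: cvg_cst].
have h1 := cvg_quotient_curve (v := v) oU Ux f1 cu.
have cx : (fun=> x) h @[h --> (0 : R)] --> x by exact: cvg_cst.
have h2 := cvg_quotient_curve (v := u) oU Ux f1 cx.
refine (cvg_trans _ (cvgD h2 h1)); apply: near_eq_cvg; near=> h => /=.
rewrite -[RHS]/(h^-1 * (f (h *: (u + v) + x) - f x)) -mulrDr scalerDr.
rewrite (addrC (h *: u) (h *: v)) -(addrA (h *: v)); congr (_ * _).
by rewrite fctE /= [LHS]addrC [LHS]addrA subrK.
Unshelve. all: by end_near. Qed.

Lemma deriveZ_dir f x u (c : R) : derivable f x u ->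
  'D_(c *: u) f x = c * 'D_u f x.
Proof.
move=> fu.
have := @is_derive_line_scale f x u c 0; rewrite mulr0 scale0r add0r => /(_ fu)[_ <-].
have eqf : (fun h : R => h^-1 *: ((f \o shift x) (h *: (c *: u)) - f x)) =
  (fun h : R => h^-1 *: (((fun t : R => f ((c * t) *: u + x)) \o shift 0) (h *: (1 : R))
     - f ((c * 0) *: u + x))).
  by apply/funext => h /=; rewrite addr0 mulr0 scale0r add0r [h%:A]mulr1 scalerA (mulrC c).
by rewrite /derive eqf.
Qed.

(** The mean value theorem is applied twice: along [u] to the increment of [f] in direction [v],
    then along [v] to ['D_u f]. The intermediate point can be kept in any prescribed neighbourhood
    of [x]. *)
Lemma second_difference U f x u v : open U -> U x -> Ck 2 U f ->
  forall V, nbhs x V -> \forall h \near (0 : R), exists2 y, V y &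
   f (h *: u + (h *: v + x)) - f (h *: v + x) - f (h *: u + x) + f x =
   h * (h * 'D_v ('D_u f) y).
Proof.
move=> oU Ux [fc fd] V nV; have [fu [fuc fuv]] := fd u; have [fuvd _] := fuv v.
have [fv _] := fd v.
have nUV : nbhs x (U `&` V) by apply: filterI => //; exact: open_nbhs_nbhs.
have [d d0 dP] := near_ball_scale nUV.
have d20 : 0 < d / 2 by rewrite divr_gt0.
have oB : open (ball (0 : E) (d / 2)) by exact: ball_open.
have B0 : ball (0 : E) (d / 2) 0 by exact: ballxx.
have bE (w : E) : ball (0 : E) (d / 2) (w + 0) -> `|w| < d / 2.
  by rewrite -ball_normE/= addr0 sub0r normrN.
near=> h.
have hu s : 0 <= s <= 1 -> `|s *: (h *: u)| < d / 2.
  by move=> s01; apply: bE; move: s s01; near: h; exact: open_line.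
have hv s : 0 <= s <= 1 -> `|s *: (h *: v)| < d / 2.
  by move=> s01; apply: bE; move: s s01; near: h; exact: open_line.
have huv s t : 0 <= s <= 1 -> 0 <= t <= 1 ->
    (U `&` V) (s *: (h *: u) + (t *: (h *: v) + x)).
  move=> s01 t01; rewrite addrA; apply: dP; apply: le_lt_trans (ler_normD _ _) _.
  by rewrite (splitr d) ltrD// ?hu ?hv.
have l01 : 0 <= (1 : R) <= 1 by rewrite ler01 lexx.
have l00 : 0 <= (0 : R) <= 1 by rewrite ler01 lexx.
pose g := (fun y => f (h *: v + y) - f y).
have fsh y : derivable f (h *: v + y) u ->
  is_derive y u (fun y => f (h *: v + y)) ('D_u f (h *: v + y)).
  have eqf : (fun k : R => k^-1 *: (((fun y => f (h *: v + y)) \o shift y) (k *: u)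
     - f (h *: v + y))) =
     (fun k : R => k^-1 *: ((f \o shift (h *: v + y)) (k *: u) - f (h *: v + y))).
    by apply/funext => k /=; rewrite addrCA.
  by move=> fdy; split; rewrite /derivable /derive/= eqf.
have gu s : 0 <= s <= 1 -> is_derive (s *: (h *: u) + x) u g
   ('D_u f (h *: v + (s *: (h *: u) + x)) - 'D_u f (s *: (h *: u) + x)).
  move=> s01; apply: is_deriveB.
    apply: fsh; apply: fu; have [+ _] := huv s 1 s01 l01.
    by rewrite scale1r addrCA.
  apply/derivableP/fu; have [+ _] := huv s 0 s01 l00.
  by rewrite scale0r add0r.
have [s s01|s s01 gE] := @MVT_line g x u h; first by have [] := gu s s01.
have [_ gE2] := gu s s01.
have [t t01|t t01 E2] := @MVT_line ('D_u f) (s *: (h *: u) + x) v h.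
  apply: fuvd; have [+ _] := huv s t s01 t01; by rewrite addrCA.
exists (t *: (h *: v) + (s *: (h *: u) + x)).
  by have [_] := huv s t s01 t01; rewrite addrCA.
rewrite -E2 -gE2 -gE /g (addrCA (h *: u)); ring.
Unshelve. all: by end_near. Qed.

End mean_value.

Lemma cvg_sum (R : numFieldType) (V : normedModType R) (I T : Type) (r : seq I) (P : pred I)
    (F : set_system T) (f : I -> T -> V) (l : I -> V) : Filter F ->
  (forall i, P i -> f i x @[x --> F] --> l i) ->
  \sum_(i <- r | P i) f i x @[x --> F] --> \sum_(i <- r | P i) l i.
Proof. by move=> FF fl; apply: cvg_big => //; exact: add_continuous. Qed.

Section clairaut.
Context {R : realType} {E : normedModType R}.
Implicit Types (U : set E).

(** For one small non-zero [h], the same number [D h] is [h ^ 2] times a value of [A] and times a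
    value of [B], both taken near [x]; continuity then forces the two limits to agree. *)
Lemma eq_limit_quotient (x : E) (A B : E -> R) (D : R -> R) :
  {for x, continuous A} -> {for x, continuous B} ->
  (forall V, nbhs x V -> \forall h \near (0 : R), exists2 y, V y & D h = h * (h * A y)) ->
  (forall V, nbhs x V -> \forall h \near (0 : R), exists2 y, V y & D h = h * (h * B y)) ->
  A x = B x.
Proof.
move=> cA cB HA HB; apply/eqP; rewrite -subr_eq0 -normr_le0; apply/ler_addgt0Pl => e e0.
rewrite addr0; have e20 : 0 < e / 2 by rewrite divr_gt0.
have H1 := HA _ ((@cvgrPdist_lt _ _ _ _ (nbhs_filter x) A (A x)).1 cA _ e20).
have H2 := HB _ ((@cvgrPdist_lt _ _ _ _ (nbhs_filter x) B (B x)).1 cB _ e20).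
have [r1 r10 r1P] := @near_ball_scale R R^o _ _ H1.
have [r2 r20 r2P] := @near_ball_scale R R^o _ _ H2.
pose h : R := Num.min r1 r2 / 2.
have h0 : 0 < h by rewrite divr_gt0// lt_min r10.
have hm : `|h| < Num.min r1 r2 by rewrite gtr0_norm// gtr_pMr ?lt_min ?r10// invf_lt1// ltr1n.
clearbody h.
move: hm; rewrite lt_min => /andP[/r1P + /r2P]; rewrite addr0 => -[y Vy yE] [z Vz zE].
have yz : A y = B z.
  by apply: (mulfI (lt0r_neq0 h0)); apply: (mulfI (lt0r_neq0 h0)); rewrite -yE -zE.
rewrite -(subrKA (A y)) (splitr e) (le_trans (ler_normD _ _))//.
apply: lerD; first exact: ltW.
by rewrite yz distrC; exact: ltW.
Qed.

Lemma derive_comm_real U (f : E -> R) x u v : open U -> U x -> Ck 2 U f ->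
  'D_u ('D_v f) x = 'D_v ('D_u f) x.
Proof.
move=> oU Ux f2.
have cD w z : {for x, continuous ('D_w ('D_z f))}.
  by have [_ /(_ z)[_ [_ /(_ w)[_ [+ _]]]]] := f2; apply.
pose D (h : R) := f (h *: u + (h *: v + x)) - f (h *: v + x) - f (h *: u + x) + f x.
apply: (@eq_limit_quotient x _ _ D (cD u v) (cD v u)) => V nV; last first.
  by have := second_difference u v oU Ux f2 nV.
have H := second_difference v u oU Ux f2 nV; apply: filterS H => h [y Vy yE].
by exists y => //; rewrite -yE /D (addrCA (h *: u)); ring.
Qed.

Lemma derive_comm m n U (f : E -> 'M[R]_(m, n)) x u v : open U -> U x -> smooth U f ->
  'D_u ('D_v f) x = 'D_v ('D_u f) x.
Proof.
move=> oU Ux sf; have sfij := (smooth_mxP f oU).1 sf.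
have dE w z : 'D_w ('D_z f) x = \matrix_(i, j) 'D_w ('D_z (fun y => f y i j)) x.
  rewrite derive_mx; last by apply: (smooth_derivable (U := U)) => //; exact: smooth_derive.
  apply/matrixP => i j; rewrite !mxE; apply: near_eq_derive.
  apply: filterS (open_nbhs_nbhs (conj oU Ux)) => y Uy.
  by rewrite derive_mx ?mxE//; exact: smooth_derivable Uy.
apply: etrans (dE u v) _; apply: etrans _ (esym (dE v u)); apply: eq_mx => i j.
exact: (@derive_comm_real U (fun y => f y i j) x u v oU Ux (sfij i j 2%N)).
Qed.

Lemma derive_dirD m n U (f : E -> 'M[R]_(m, n)) x u v : open U -> U x -> smooth U f ->
  'D_(u + v) f x = 'D_u f x + 'D_v f x.
Proof.
move=> oU Ux sf; have sfij := (smooth_mxP f oU).1 sf.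
rewrite !derive_mx; do ?exact: smooth_derivable Ux.
by apply/matrixP => i j; rewrite !mxE (deriveD_dir _ _ oU Ux (sfij i j 1%N)).
Qed.

Lemma derive_dirZ m n U (f : E -> 'M[R]_(m, n)) x u (c : R) : open U -> U x -> smooth U f ->
  'D_(c *: u) f x = c *: 'D_u f x.
Proof.
move=> oU Ux sf; have sfij := (smooth_mxP f oU).1 sf.
rewrite !derive_mx; do ?exact: smooth_derivable Ux.
apply/matrixP => i j; rewrite !mxE deriveZ_dir//.
exact: smooth_derivable (sfij i j) Ux.
Qed.

Lemma derive_dir_sum m n U (f : E -> 'M[R]_(m, n)) x (I : Type) (r : seq I) (P : pred I)
    (c : I -> R) (u : I -> E) : open U -> U x -> smooth U f ->
  'D_(\sum_(i <- r | P i) c i *: u i) f x = \sum_(i <- r | P i) c i *: 'D_(u i) f x.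
Proof.
move=> oU Ux sf; elim/big_rec2: _ => [|i w v _ <-]; first exact: derive0.
by rewrite (derive_dirD _ _ oU Ux)// (derive_dirZ _ _ oU Ux).
Qed.

End clairaut.

(** * The chain rule *)

Section chain.
Context {R : realType} {n : nat}.
Implicit Types (U : set 'rV[R]_n).

Lemma rV_basis (u : 'rV[R]_n) : u = \sum_i u 0 i *: basis_vec R i.
Proof. by rewrite {1}[u]row_sum_delta. Qed.

Lemma derive_rV p q U (f : 'rV[R]_n -> 'M[R]_(p, q)) x u : open U -> U x -> smooth U f ->
  'D_u f x = \sum_i u 0 i *: 'D_(basis_vec R i) f x.
Proof. by move=> oU Ux sf; rewrite {1}[u]rV_basis (derive_dir_sum _ _ _ _ oU Ux). Qed.

Lemma derive_rV_real U (f : 'rV[R]_n -> R) x u : open U -> U x -> Ck 1 U f ->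
  'D_u f x = \sum_i u 0 i * 'D_(basis_vec R i) f x.
Proof.
move=> oU Ux f1; rewrite {1}[u]rV_basis.
elim/big_rec2: _ => [|i w v _ <-]; first exact: derive0.
rewrite (deriveD_dir _ _ oU Ux)// deriveZ_dir//.
by have [_ /(_ (basis_vec R i)) [+ _]] := f1; apply.
Qed.

(** Since [phi] is only derivable in the one direction [v], the increment of [f] is handled by the
    mean value theorem on the segment from [phi y] to [phi (h *: v + y)], and the C^1 assumption on
    [f] gives the limit. *)
Lemma is_derive_comp_real (E : normedModType R) U (f : 'rV[R]_n -> R) (phi : E -> 'rV[R]_n)
   (y v : E) w : open U -> U (phi y) -> Ck 1 U f -> is_derive y v phi w ->
  is_derive y v (f \o phi) ('D_w f (phi y)).
Proof.
move=> oU Ux f1 [pd pw].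
have [fc fd] := f1.
have cphi : phi (h *: v + y) @[h --> (0 : R)] --> phi y.
  have dl := (derivable1P phi y v).1 pd.
  have E0 : (0 : R) *: v + y = y by rewrite scale0r add0r.
  by rewrite -[in X in _ --> X]E0; exact: (differentiable_continuous ((derivable1_diffP _ _).1 dl)).
have pq : h^-1 *: (phi (h *: v + y) - phi y) @[h --> (0 : R)^'] --> w.
  by rewrite -pw; exact: pd.
suff lim : h^-1 *: (f (phi (h *: v + y)) - f (phi y)) @[h --> (0 : R)^'] --> 'D_w f (phi y).
  split; first by apply/cvg_ex; eexists; exact: lim.
  exact: cvg_lim lim.
have [d d0 dP] := near_ball_scale (open_nbhs_nbhs (conj oU Ux)).
(* The guard makes the statement true for every [h], with [phi y] as a default, so that the
   intermediate point becomes a total function of [h]. *)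
have Hex (h : R) : exists z : 'rV[R]_n,
   `|phi (h *: v + y) - phi y| < d ->
   [/\ `|z - phi y| <= `|phi (h *: v + y) - phi y|, U z &
     f (phi (h *: v + y)) - f (phi y) = 'D_(phi (h *: v + y) - phi y) f z].
  have [hd|] := pselect (`|phi (h *: v + y) - phi y| < d); last first.
    by move=> hd; exists (phi y) => /hd.
  set D := phi _ - phi y in hd *.
  have sD (s : R) : 0 <= s <= 1 -> `|s *: D| <= `|D|.
    by move=> /andP[s0 s1]; rewrite normrZ ger0_norm// ler_piMl.
  have [s s01|s s01] := @MVT_line R _ f (phi y) D 1.
    have [fv _] := fd D; apply: fv; apply: dP; rewrite scale1r.
    by rewrite (le_lt_trans (sD _ s01)).
  rewrite scale1r mul1r {1}/D subrK => ->.
  exists (s *: D + phi y) => _; split=> //; first by rewrite addrK sD.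
  by apply: dP; rewrite (le_lt_trans (sD _ s01)).
pose z h := sval (cid (Hex h)).
have zP h : `|phi (h *: v + y) - phi y| < d ->
   [/\ `|z h - phi y| <= `|phi (h *: v + y) - phi y|, U (z h) &
     f (phi (h *: v + y)) - f (phi y) = 'D_(phi (h *: v + y) - phi y) f (z h)].
  exact: (svalP (cid (Hex h))).
have nd : \forall h \near (0 : R), `|phi (h *: v + y) - phi y| < d.
  by have /cvgrPdist_lt/(_ _ d0) := cphi; apply: filterS => h; rewrite distrC.
have zc : z h @[h --> (0 : R)^'] --> phi y.
  apply/cvgrPdist_le => e e0; apply: cvg_within; near=> h.
  have [+ _ _] : [/\ `|z h - phi y| <= `|phi (h *: v + y) - phi y|, U (z h) &
     f (phi (h *: v + y)) - f (phi y) = 'D_(phi (h *: v + y) - phi y) f (z h)].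
    by apply: zP; near: h.
  rewrite distrC => /le_trans; apply; rewrite distrC; near: h.
  by have /cvgrPdist_le := cphi; apply.
rewrite (derive_rV_real _ oU Ux)//.
(* The direction of the mean value varies with [h]. Expanded in the basis, the quotient is a finite
   sum of products of a convergent coordinate and a partial derivative that is continuous at
   [phi y]. *)
have lims : \sum_i (h^-1 *: (phi (h *: v + y) - phi y)) 0 i * 'D_(basis_vec R i) f (z h)
   @[h --> (0 : R)^'] --> \sum_i w 0 i * 'D_(basis_vec R i) f (phi y).
  apply: cvg_sum => i _; apply: cvgM.
    by have /cvg_mxP := pq; apply.
  apply: (@cvg_comp _ _ _ z ('D_(basis_vec R i) f) _ (nbhs (phi y))) => //.
  by have [_ [+ _]] := fd (basis_vec R i); apply.
refine (cvg_trans _ lims); apply: near_eq_cvg; apply: cvg_within; near=> h.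
have [_ Uz ->] : [/\ `|z h - phi y| <= `|phi (h *: v + y) - phi y|, U (z h) &
     f (phi (h *: v + y)) - f (phi y) = 'D_(phi (h *: v + y) - phi y) f (z h)].
  by apply: zP; near: h.
rewrite (derive_rV_real _ oU Uz)// scaler_sumr; apply: eq_bigr => i _.
by rewrite [X in X * _]mxE -[RHS]/(h^-1 * _) -mulrA.
Unshelve. all: by end_near. Qed.

Lemma is_derive_comp_mx (E : normedModType R) p q U (f : 'rV[R]_n -> 'M[R]_(p, q))
   (phi : E -> 'rV[R]_n) (y v : E) w :
  open U -> U (phi y) -> smooth U f -> is_derive y v phi w ->
  is_derive y v (fun y => f (phi y)) ('D_w f (phi y)).
Proof.
move=> oU Ux sf dphi; apply/is_derive_mx => i j.
rewrite derive_mx; last exact: smooth_derivable Ux.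
rewrite mxE.
have fij : Ck 1 U (fun x => f x i j) by have /smooth_mxP/(_ i j 1%N) := sf; apply.
exact: (is_derive_comp_real oU Ux fij dphi).
Qed.

End chain.

(** * Extrema and quadratic forms *)

Section extremum.
Context {R : realType}.

(** Only times before [t] are compared, so the derivative gets a sign and need not vanish: [t] may
    be the right end of the interval. *)
Lemma derive_left_max_ge0 (phi : R -> R) (t d : R) : 0 < t -> is_derive t 1 phi d ->
  (forall s, 0 <= s <= t -> phi s <= phi t) -> 0 <= d.
Proof.
move=> t0 [pd pv] pmax; rewrite leNgt; apply/negP => d0.
have lim : h^-1 *: ((phi \o shift t) (h *: 1) - phi t) @[h --> (0 : R)^'] --> d.
  by rewrite -pv; exact: pd.
have /cvgrPdist_lt/(_ (- d)) := lim.
rewrite oppr_gt0 => /(_ d0) /nbhs_ballP[r r0 rP].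
pose k : R := Num.min r t / 2.
have m0 : 0 < Num.min r t by rewrite lt_min r0.
have k0 : 0 < k by rewrite divr_gt0.
have km : k < Num.min r t by rewrite gtr_pMr// invf_lt1// ltr1n.
move: km; rewrite lt_min => /andP[kr kt].
have := rP (- k) _ _; rewrite /= -ball_normE/= sub0r opprK gtr0_norm// => /(_ kr).
rewrite oppr_eq0 => /(_ (lt0r_neq0 k0)).
rewrite [- k *: 1]mulr1 -[X in `|_ - X|]/((- k)^-1 * (phi (- k + t) - phi t)).
rewrite invrN mulNr opprK => H.
have p1 : phi (- k + t) <= phi t by apply: pmax; lra.
have : k^-1 * (phi (- k + t) - phi t) <= 0.
  by rewrite pmulr_rle0 ?invr_gt0// subr_le0.
move: H; set q := k^-1 * _; rewrite ltr_norml; lra.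
Qed.

Context {E : normedModType R}.
Implicit Types (U : set E) (f : E -> R).

Lemma derive_local_max U f x u : open U -> U x -> Ck 1 U f ->
  (\forall y \near x, f y <= f x) -> 'D_u f x = 0.
Proof.
move=> oU Ux [fc fd] fmax; have [fu _] := fd u.
have ux : x = (0 : R) *: u + x by rewrite scale0r add0r.
have [d0 dv] : is_derive (0 : R) (1 : R) (fun t : R => f (t *: u + x)) ('D_u f (0 *: u + x)).
  by apply: is_derive_line; rewrite -ux; exact: fu.
have [r r0 rP] := near_ball_scale (filterI (open_nbhs_nbhs (conj oU Ux)) fmax).
pose e : R := r / (`|u| + 1).
have u1 : 0 < `|u| + 1 by rewrite ltr_wpDl.
have e0 : 0 < e by rewrite divr_gt0.
have eP (t : R) : t \in `]- e, e[ -> U (t *: u + x) /\ f (t *: u + x) <= f x.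
  rewrite in_itv/= -ltr_norml => te; apply: rP.
  rewrite normrZ (@le_lt_trans _ _ (`|t| * (`|u| + 1)))// ?ler_wpM2l ?lerDl//.
  by rewrite -ltr_pdivlMr.
rewrite ux -dv.
have [||||_ //] := @derive1_at_max R (fun t : R => f (t *: u + x)) (- e) e 0.
- by rewrite ge0_cp// ltW.
- move=> t /eP[Ut _]; have [] // := @is_derive_line R E _ f x u t.
  exact: fu.
- by rewrite in_itv/= oppr_lt0 e0.
- by move=> t /eP[_]; rewrite -ux.
Qed.

(** If the second derivative were positive, ['D_u f], which vanishes at [x], would be positive
    shortly beyond [x] in direction [u], and [f] would exceed its maximum there. *)
Lemma derive2_local_max U f x u : open U -> U x -> Ck 2 U f ->
  (\forall y \near x, f y <= f x) -> 'D_u ('D_u f) x <= 0.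
Proof.
move=> oU Ux f2 fmax; have D0 := derive_local_max u oU Ux (CkS f2) fmax.
have [fc fd] := f2; have [fu [_ fuu]] := fd u; have [fuud _] := fuu u.
rewrite leNgt; apply/negP => c0.
have lim : h^-1 *: (('D_u f \o shift x) (h *: u) - 'D_u f x) @[h --> (0 : R)^']
   --> 'D_u ('D_u f) x by exact: fuud.
have /cvgrPdist_lt/(_ _ c0) /nbhs_ballP[r r0 rP] := lim.
have [d d0 dP] := near_ball_scale (filterI (open_nbhs_nbhs (conj oU Ux)) fmax).
have u1 : 0 < `|u| + 1 by rewrite ltr_wpDl.
pose k : R := Num.min r (d / (`|u| + 1)) / 2.
have m0 : 0 < Num.min r (d / (`|u| + 1)) by rewrite lt_min r0 divr_gt0.
have k0 : 0 < k by rewrite divr_gt0.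
have km : k < Num.min r (d / (`|u| + 1)) by rewrite gtr_pMr// invf_lt1// ltr1n.
move: km; rewrite lt_min => /andP[kr kd].
have ks (s : R) : 0 <= s <= 1 -> U (s *: (k *: u) + x) /\ f (s *: (k *: u) + x) <= f x.
  move=> /andP[s0 s1]; apply: dP; rewrite normrZ ger0_norm//.
  rewrite (le_lt_trans (ler_piMl _ s1))// normrZ gtr0_norm//.
  rewrite (@le_lt_trans _ _ (k * (`|u| + 1)))// ?ler_wpM2l ?lerDl// ?ltW//.
  by rewrite -ltr_pdivlMr.
(* The intermediate point must satisfy [0 < s]: the quotient of ['D_u f] at [x] is evaluated at the
   increment [s * k], by which it divides. *)
have [s /ks[Us _]|s /andP[s0 s1]] := @MVT_line_oo R E f x u k.
  exact: fu.
move=> E1; have /ks[_] : 0 <= (1 : R) <= 1 by rewrite ler01 lexx.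
rewrite scale1r -subr_le0 E1 pmulr_rle0//.
have sk0 : 0 < s * k by rewrite mulr_gt0.
have skr : s * k < r by rewrite (le_lt_trans (ler_piMl (ltW k0) (ltW s1))).
have := rP (s * k) _ (lt0r_neq0 sk0); rewrite /= -ball_normE/= sub0r normrN gtr0_norm// => /(_ skr).
rewrite D0 subr0 scalerA; set D := 'D_u f _; set c := 'D_u ('D_u f) x in c0 *.
rewrite -[X in `|_ - X|]/((s * k)^-1 * D) => H Dle.
have : (s * k)^-1 * D <= 0 by rewrite pmulr_rle0 ?invr_gt0.
by move: H; set q := (s * k)^-1 * D; rewrite ltr_norml; lra.
Qed.

End extremum.

Section forms.
Context {R : realType}.

Lemma form_sqr_eq0 n (v : 'rV[R]_n) : (v *m v^T) 0 0 <= 0 -> v = 0.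
Proof.
rewrite mxE => H; apply/rowP => j; rewrite mxE.
have H0 k : 0 <= v 0 k * v^T k 0 by rewrite mxE -expr2 sqr_ge0.
have := psumr_eq0P (fun k _ => H0 k) (le_anti (introT andP (conj H (sumr_ge0 _ (fun k _ => H0 k))))).
by move=> /(_ j isT)/eqP; rewrite mxE mulf_eq0 orbb => /eqP.
Qed.

(** The vector [v] maximises the form, so moving it along [u = v *m S] cannot increase the value. To
    first order the gain is [2 t |u|^2], hence [u = 0]. *)
Lemma nonpos_form_ker n (S : 'M[R]_n) (v : 'rV[R]_n) : S^T = S ->
  (forall w : 'rV_n, (w *m S *m w^T) 0 0 <= 0) -> (v *m S *m v^T) 0 0 = 0 -> v *m S = 0.
Proof.
move=> Ssym Sle v0; set u := v *m S; apply: form_sqr_eq0.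
set a := (u *m u^T) 0 0; pose b := (u *m S *m u^T) 0 0.
have uv : u *m S *m v^T = (u *m u^T).
  by rewrite -mulmxA; congr (_ *m _); rewrite /u trmx_mul Ssym.
have H (t : R) : 2 * t * a + t ^+ 2 * b <= 0.
  have := Sle (v + t *: u).
  have -> : (v + t *: u) *m S *m (v + t *: u)^T = v *m S *m v^T + t *: (u *m u^T)
     + (t *: (u *m u^T) + (t * t) *: (u *m S *m u^T)).
    rewrite !mulmxDl linearD/= [(t *: u)^T]linearZ/= !mulmxDr -!scalemxAl -!scalemxAr.
    by rewrite uv scalerA.
  have addE (A B : 'M[R]_1) : (A + B) 0 0 = A 0 0 + B 0 0 by rewrite mxE.
  have scaleE (k : R) (A : 'M[R]_1) : (k *: A) 0 0 = k * A 0 0 by rewrite mxE.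
  by rewrite !addE !scaleE v0 -/a -/b; apply: le_trans; rewrite expr2; lra.
have ble : b <= 0 by exact: Sle.
have [b0|b0] := eqVneq b 0; first by have := H 1; rewrite b0; lra.
have bn : b < 0 by rewrite lt_neqAle b0.
rewrite leNgt; apply/negP => a0.
(* This [t] is the vertex of the parabola [2 t a + t ^ 2 b], where its value [- a ^ 2 / b] is
   positive. *)
have := H (- a / b); rewrite expr2.
have -> : 2 * (- a / b) * a + (- a / b) * (- a / b) * b = - (a ^+ 2 / b) by field.
by rewrite leNgt oppr_gt0 pmulr_rlt0 ?exprn_gt0// invr_lt0 bn.
Qed.

(** The rows of [E] form an orthonormal basis for [G]. The induction is on the Schur complement: [L]
    clears the first row and column, leaving a positive scalar and [S], which is positive definite
    because it represents [G] on the vectors [row_mx 0 w *m L]. *)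
Lemma posdef_orthonormal n (G : 'M[R]_n) : G^T = G ->
  (forall w : 'rV_n, w != 0 -> 0 < (w *m G *m w^T) 0 0) ->
  exists E : 'M[R]_n, E *m G *m E^T = 1%:M.
Proof.
elim: n G => [|n IH] G Gsym Gpos.
  by exists 1%:M; apply/matrixP => -[].
rewrite -[n.+1]/(1 + n)%N in G Gsym Gpos *.
set a := ulsubmx G; set r := ursubmx G; set r' := dlsubmx G; set G' := drsubmx G.
have GE : G = block_mx a r r' G' by rewrite submxK.
have r'E : r' = r^T.
  by rewrite /r' /r -[in LHS]Gsym trmx_ursub.
have G'sym : G'^T = G' by rewrite /G' trmx_drsub Gsym.
set x := a 0 0; have aE : a = x%:M by rewrite [a]mx11_scalar.
have x0 : 0 < x.
  have := Gpos (row_mx 1%:M 0); rewrite GE.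
  rewrite mul_row_block tr_row_mx mul_row_col !mul1mx !mul0mx !addr0 trmx1 trmx0 mulmx1 mulmx0.
  rewrite addr0; apply; apply/eqP => /(congr1 lsubmx).
  rewrite row_mxKl => /matrixP/(_ 0 0); rewrite lsubmxEsub !mxE/= => /eqP.
  by rewrite oner_eq0.
pose L : 'M[R]_(1 + n) := block_mx 1%:M 0 (- x^-1 *: r^T) 1%:M.
pose S := G' - x^-1 *: (r^T *m r).
have LGL : L *m G *m L^T = block_mx a 0 0 S.
  rewrite GE r'E /L (tr_block_mx 1%:M) !trmx1 trmx0 linearZ/= trmxK !mulmx_block.
  rewrite !mul1mx !mul0mx !mulmx1 ?mulmx0 ?addr0 ?add0r aE.
  rewrite mul_mx_scalar mul_scalar_mx !scalerA !mulrN mulfV ?lt0r_neq0// !scaleN1r !addNr.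
  by rewrite mul0mx add0r -scalemxAl scaleNr addrC.
have [|w w0|E' E'P] := IH S.
- by rewrite /S linearB/= linearZ/= trmx_mul trmxK G'sym.
- have := Gpos (row_mx 0 w *m L).
  have -> : row_mx 0 w *m L *m G *m (row_mx 0 w *m L)^T = w *m S *m w^T.
    rewrite trmx_mul !mulmxA -(mulmxA (row_mx 0 w) L G) -(mulmxA _ (L *m G)) LGL.
    rewrite mul_row_block tr_row_mx mul_row_col !mul0mx !mulmx0 !add0r trmx0 ?mulmx0.
    by rewrite ?add0r.
  apply; apply: contra w0 => /eqP/(congr1 rsubmx).
  rewrite mul_row_block row_mxKr mul0mx mulmx1 add0r => ->.
  by apply/eqP/matrixP => i j; rewrite !mxE.
exists (block_mx (Num.sqrt x)^-1%:M 0 0 E' *m L).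
rewrite trmx_mul !mulmxA -(mulmxA _ L G) -(mulmxA _ (L *m G)) LGL.
rewrite (tr_block_mx _ 0) !trmx0 !mulmx_block !mul0mx !mulmx0 !addr0 !add0r E'P.
rewrite aE tr_scalar_mx -!scalar_mxM [RHS](@scalar_mx_block _ 1 n 1); congr (block_mx _%:M _ _ _); rewrite ?mul0mx//.
by rewrite -mulrA mulrCA -invfM -expr2 sqr_sqrtr ?ltW// mulfV ?lt0r_neq0.
Qed.

(** In a basis [E] orthonormal for [G] one has [invmx G = E^T *m E], so the trace is the sum of the
    values of [H] on the rows of [E]. This passes from second derivatives in each direction to the
    Laplacian. *)
Lemma trace_posdef_nonpos n (G H : 'M[R]_n) : G^T = G ->
  (forall w : 'rV_n, w != 0 -> 0 < (w *m G *m w^T) 0 0) ->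
  (forall w : 'rV_n, (w *m H *m w^T) 0 0 <= 0) ->
  \sum_i \sum_j invmx G i j * H i j <= 0.
Proof.
move=> Gsym Gpos Hle; have [E EG] := posdef_orthonormal Gsym Gpos.
have [Eu _] := mulmx1_unit (etrans (mulmxA _ _ _) EG).
have Gi : invmx G = E^T *m E.
  have GE : G *m (E^T *m E) = 1%:M.
    by rewrite mulmxA; apply: mulmx1C; rewrite mulmxA.
  have [Gu _] := mulmx1_unit GE.
  by rewrite -[RHS](mulKmx Gu) GE mulmx1.
have -> : \sum_i \sum_j invmx G i j * H i j = \sum_k (row k E *m H *m (row k E)^T) 0 0.
  transitivity (\sum_i \sum_j \sum_k E k i * H i j * E k j).
    apply: eq_bigr => i _; apply: eq_bigr => j _; rewrite Gi mxE mulr_suml.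
    by apply: eq_bigr => k _; rewrite mxE; ring.
  rewrite exchange_big/=; under eq_bigr do rewrite exchange_big/=.
  rewrite exchange_big/=; apply: eq_bigr => k _; rewrite mxE; apply: eq_bigr => j _.
  by rewrite !mxE mulr_suml; apply: eq_bigr => i _; rewrite mxE.
by apply: sumr_le0 => k _; exact: Hle.
Qed.

End forms.

(** * The Levi-Civita connection in a chart *)

(* Row-vector convention: Gamma(u, w) is w *m connection_mx g y u. *)
Definition connection_mx (R : realType) (n : nat) (g : 'rV[R]_n -> 'M[R]_n) (y u : 'rV[R]_n) : 'M[R]_n :=
  \matrix_(j, k) \sum_i christoffel g y k i j * u 0 i.

Section connection.
Context {R : realType} {n : nat}.
Variable g : 'rV[R]_n -> 'M[R]_n.
Implicit Types (y u v w : 'rV[R]_n).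

Lemma covE u Z y : cov g u Z y = 'D_u Z y + Z y *m connection_mx g y u.
Proof.
rewrite /cov; congr (_ + _); apply/rowP => k; rewrite mxE [RHS]mxE exchange_big/=.
apply: eq_bigr => j _; rewrite [connection_mx _ _ _ _ _]mxE mulr_sumr; apply: eq_bigr => i _.
by rewrite mulrC.
Qed.

Lemma connection_mxD y u v : connection_mx g y (u + v) = connection_mx g y u + connection_mx g y v.
Proof.
apply/matrixP => j k; rewrite [RHS]mxE [LHS]mxE [X in _ = X + _]mxE [X in _ = _ + X]mxE.
by rewrite -big_split/=; apply: eq_bigr => i _; rewrite mxE mulrDr.
Qed.

Lemma connection_mxZ y c u : connection_mx g y (c *: u) = c *: connection_mx g y u.
Proof.
apply/matrixP => j k; rewrite [RHS]mxE [LHS]mxE [X in _ = _ * X]mxE.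
by rewrite mulr_sumr; apply: eq_bigr => i _; rewrite mxE mulrCA.
Qed.

Lemma connection_mx_sum y u : connection_mx g y u = \sum_i u 0 i *: connection_mx g y (basis_vec R i).
Proof.
rewrite {1}[u]rV_basis; elim/big_rec2: _ => [|i w v _ <-]; last by rewrite connection_mxD connection_mxZ.
by rewrite -(scale0r 0) connection_mxZ !scale0r.
Qed.

Lemma cov_cstE u w y : cov g u (cst w) y = w *m connection_mx g y u.
Proof. by rewrite covE derive_cst add0r. Qed.

Lemma cst_mulmx_is_derive (m p q : nat) (M : 'M[R]_(m, p)) (A : 'rV[R]_n -> 'M[R]_(p, q)) y u dA :
  is_derive y u A dA -> is_derive y u (fun z => M *m A z) (M *m dA).
Proof.
move=> dAy; have := is_derive_mulmx (is_derive_cst M y u) dAy.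
by rewrite mul0mx add0r.
Qed.

(** The covariant derivative of an endomorphism is the plain derivative plus a commutator with the
    connection, in row-vector order. *)
Lemma cov_endoE u A y : derivable A y u ->
  cov_endo g u A y = 'D_u A y + A y *m connection_mx g y u - connection_mx g y u *m A y.
Proof.
move=> dA; apply/row_matrixP => i; rewrite rowK cov_cstE covE.
have [_ ->] := cst_mulmx_is_derive (basis_vec R i) (derivableP dA).
by rewrite -!mulmxA -mulmxDr -mulmxBr -rowE.
Qed.

Variable U : set 'rV[R]_n.
Hypothesis oU : open U.
Hypothesis gs : smooth U g.
Hypothesis gsym : forall y, U y -> (g y)^T = g y.
Hypothesis gpos : forall y, U y -> forall v, v != 0 -> 0 < ip (g y) v v.

Lemma metric_unit y : U y -> g y \in unitmx.
Proof.
move=> Uy; rewrite -row_free_unit; apply/inj_row_free => v vg.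
apply: contraTeq isT => v0; have := gpos Uy v0.
by rewrite /ip vg mul0mx mxE ltxx.
Qed.

Lemma christoffelE y k i j : U y -> christoffel g y k i j =
  2^-1 * \sum_l invmx (g y) k l * (('D_(basis_vec R i) g y) j l +
    ('D_(basis_vec R j) g y) i l - ('D_(basis_vec R l) g y) i j).
Proof.
move=> Uy; rewrite /christoffel; congr (_ * _); apply: eq_bigr => l _; congr (_ * _).
rewrite !derive_mx; do ?exact: smooth_derivable Uy.
by rewrite [X in _ = X + _ - _]mxE [X in _ = _ + X - _]mxE [X in _ = _ + _ - X]mxE.
Qed.

Lemma derive_metric_sym y u : U y -> ('D_u g y)^T = 'D_u g y.
Proof.
move=> Uy; have [_ <-] := is_derive_trmx (smooth_is_derive u gs Uy).
apply: near_eq_derive; apply: filterS (open_nbhs_nbhs (conj oU Uy)) => z.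
exact: gsym.
Qed.

Lemma christoffel_sym y k i j : U y -> christoffel g y k i j = christoffel g y k j i.
Proof.
move=> Uy; rewrite !christoffelE//; congr (_ * _); apply: eq_bigr => l _; congr (_ * _).
rewrite (addrC (_ j l)); congr (_ - _).
by rewrite -{1}(derive_metric_sym _ Uy) mxE.
Qed.

(** Torsion-freeness: the Christoffel symbols inherit the symmetry of the metric in their lower
    indices. *)
Lemma connection_mx_sym y u w : U y -> w *m connection_mx g y u = u *m connection_mx g y w.
Proof.
move=> Uy; apply/rowP => k; rewrite mxE [RHS]mxE.
under eq_bigr do rewrite mxE mulr_sumr.
under [RHS]eq_bigr do rewrite mxE mulr_sumr.
rewrite exchange_big/=; apply: eq_bigr => i _; apply: eq_bigr => j _.
by rewrite christoffel_sym//; ring.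
Qed.

(** Multiplication by the metric cancels its inverse and leaves the Christoffel symbols of the first
    kind, with [P] naming the partial derivatives of the metric. *)
Lemma connection_mx_metric y u (P : 'I_n -> 'M[R]_n) j m :
  (forall i, 'D_(basis_vec R i) g y = P i) -> U y -> (connection_mx g y u *m g y) j m =
  2^-1 * \sum_i u 0 i * (P i j m + P j i m - P m i j).
Proof.
move=> PE Uy; rewrite mxE.
under eq_bigr do rewrite mxE mulr_suml.
rewrite exchange_big/= mulr_sumr; apply: eq_bigr => i _.
pose d := fun l => P i j l + P j i l - P l i j.
transitivity (2^-1 * (u 0 i * \sum_l d l * (g y *m invmx (g y)) m l)).
  under [in RHS]eq_bigr do rewrite mxE mulr_sumr.
  rewrite exchange_big/= !mulr_sumr; apply: eq_bigr => k _.
  have -> : christoffel g y k i j = 2^-1 * \sum_l invmx (g y) k l * d l.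
    rewrite christoffelE// PE PE; congr (_ * _); apply: eq_bigr => l _.
    by rewrite PE.
  rewrite -!mulrA; congr (_ * _); rewrite mulrC -mulrA; congr (_ * _).
  rewrite mulrC mulr_suml; apply: eq_bigr => l _.
  have -> : g y k m = g y m k by rewrite -{1}gsym// mxE.
  ring.
rewrite -/(d m); clearbody d; congr (_ * (_ * _)).
rewrite mulmxV ?metric_unit// (bigD1 m)//= mxE eqxx mulr1.
by rewrite big1 ?addr0// => l lm; rewrite mxE eq_sym (negbTE lm) mulr0.
Qed.

(** The covariant derivative of the metric vanishes: when the first-kind symbols are added with
    their two last indices exchanged, four of the six terms cancel and the other two coincide. *)
Lemma metric_compatible y u : U y ->
  'D_u g y = connection_mx g y u *m g y + g y *m (connection_mx g y u)^T.
Proof.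
move=> Uy; have -> : g y *m (connection_mx g y u)^T = (connection_mx g y u *m g y)^T.
  by rewrite trmx_mul gsym.
have [P PE] : exists P : 'I_n -> 'M[R]_n, forall i, 'D_(basis_vec R i) g y = P i by eexists.
have S i0 j0 k0 : P i0 j0 k0 = P i0 k0 j0.
  by rewrite -PE -{1}(derive_metric_sym _ Uy) mxE.
have -> : 'D_u g y = \sum_i u 0 i *: P i.
  by rewrite (derive_rV u oU Uy gs); apply: eq_bigr => i _; rewrite PE.
apply/matrixP => j m; rewrite [RHS]mxE [X in _ = _ + X]mxE !(connection_mx_metric _ _ _ PE)// -mulrDr.
rewrite summxE -big_split/= mulr_sumr; apply: eq_bigr => i _.
by rewrite mxE (S i m j); field.
Qed.

Lemma connection_mx_smooth u : smooth U (fun y => connection_mx g y u).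
Proof.
apply/smooth_mxP => // j k.
apply: (@smooth_eq _ _ _ _ (fun y => \sum_i u 0 i *: (2^-1 *: (\sum_l invmx (g y) k l *
 (('D_(basis_vec R i) g y) j l +
    ('D_(basis_vec R j) g y) i l - ('D_(basis_vec R l) g y) i j))) : R^o)) => //.
  move=> y Uy; rewrite mxE; apply: eq_bigr => i _.
  by rewrite christoffelE// mulrC.
have dgs i j0 k0 : smooth U (fun y => ('D_(basis_vec R i) g y) j0 k0 : R^o).
  by have := smooth_derive (basis_vec R i) gs; move/(smooth_mxP _ oU); apply.
have gis i j0 : smooth U (fun y => invmx (g y) i j0 : R^o).
  have := smooth_invmx oU (fun y Uy => metric_unit Uy) gs.
  by move/(smooth_mxP _ oU); apply.
apply: smooth_sum => // i _; apply: smoothZ => //; apply: smoothZ => //.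
apply: smooth_sum => // l _; apply: smoothM => //.
by apply: smoothB => //; apply: smoothD.
Qed.

Lemma nablaE Z y v : smooth U Z -> U y ->
  v *m nabla g Z y = 'D_v Z y + Z y *m connection_mx g y v.
Proof.
move=> Zs Uy; rewrite mulmx_sum_row.
under eq_bigr do rewrite rowK covE scalerDr.
rewrite big_split/= -(derive_rV v oU Uy Zs); congr (_ + _).
by rewrite connection_mx_sum mulmx_sumr; apply: eq_bigr => i _; rewrite scalemxAr.
Qed.

Lemma nabla_smooth Z : smooth U Z -> smooth U (nabla g Z).
Proof.
move=> Zs; apply/smooth_mxP => // i j.
have H : smooth U (fun y => 'D_(basis_vec R i) Z y + Z y *m connection_mx g y (basis_vec R i)).
  apply: smoothD => //; first exact: smooth_derive.
  by apply: smooth_mulmx => //; exact: connection_mx_smooth.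
move/(smooth_mxP _ oU) : H => /(_ 0 j); apply: smooth_eq => // y Uy.
by rewrite [RHS]mxE covE.
Qed.

Lemma cov_endo_smooth u A : smooth U A -> smooth U (fun y => cov_endo g u A y).
Proof.
move=> As; apply: (@smooth_eq _ _ _ _ (fun y => 'D_u A y + A y *m connection_mx g y u - connection_mx g y u *m A y)) => //.
  by move=> y Uy; rewrite cov_endoE//; exact: smooth_derivable Uy.
have Gs := connection_mx_smooth u.
by apply: smoothB => //; [apply: smoothD => //; [exact: smooth_derive|]|]; apply: smooth_mulmx.
Qed.

(** The formula for the curvature as the exterior derivative of the connection matrix plus a
    quadratic term. Acting on row vectors from the right reverses the order of the products. *)
Lemma RmE y u v w : U y -> Rm g y u v w =
  w *m ('D_u (fun z => connection_mx g z v) y + connection_mx g y v *m connection_mx g y u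
      - 'D_v (fun z => connection_mx g z u) y - connection_mx g y u *m connection_mx g y v).
Proof.
move=> Uy; rewrite /Rm.
have E v0 : (fun z => cov g v0 (cst w) z) = (fun z => w *m connection_mx g z v0).
  by apply/funext => z; rewrite cov_cstE.
have D u0 v0 : 'D_u0 (fun z => w *m connection_mx g z v0) y = w *m 'D_u0 (fun z => connection_mx g z v0) y.
  by have [_ ->] := cst_mulmx_is_derive w (smooth_is_derive u0 (connection_mx_smooth v0) Uy).
rewrite !E !covE !D; move: ('D_u _ y) ('D_v _ y) => Du Dv.
by rewrite -!mulmxA -!mulmxDr -mulmxBr; congr (_ *m _); rewrite opprD addrA.
Qed.

(** This is the Ricci identity in disguise: exchanging the two derivatives of [X] produces the
    curvature. In coordinates the second derivatives of [X] cancel by [derive_comm], and the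
    derivatives of the connection assemble into [Rm]. *)
Lemma cov_nabla_along X y v : smooth U X -> U y ->
  cov g v (fun z => X z *m nabla g X z) y =
  Rm g y v (X y) (X y) + v *m nabla g X y *m nabla g X y
   + v *m cov_endo g (X y) (nabla g X) y.
Proof.
move=> Xs Uy; set x := X y.
have Ns := nabla_smooth Xs.
have dX w := smooth_is_derive w Xs Uy.
have dN w := smooth_is_derive w Ns Uy.
have dG w u := smooth_is_derive w (connection_mx_smooth u) Uy.
rewrite covE; have [_ ->] := is_derive_mulmx (dX v) (dN v).
rewrite cov_endoE; last by have [] := dN x.
(* The derivative of the matrix field [nabla g X] is obtained by differentiating [nablaE] for a
   vector [w] with constant components. *)
have DN u w : w *m 'D_u (nabla g X) y = 'D_u ('D_w X) y
   + 'D_u X y *m connection_mx g y w + x *m 'D_u (fun z => connection_mx g z w) y.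
  have [_ <-] := cst_mulmx_is_derive w (dN u).
  rewrite (near_eq_derive (g := fun z => 'D_w X z + X z *m connection_mx g z w)); last first.
    by apply: filterS (open_nbhs_nbhs (conj oU Uy)) => z Uz; rewrite nablaE.
  have D1 := smooth_is_derive u (smooth_derive w Xs) Uy.
  have D2 := is_derive_mulmx (dX u) (dG u w).
  by have [_ ->] := is_deriveD D1 D2; rewrite addrA.
have vN := nablaE v Xs Uy; have xN := nablaE x Xs Uy.
rewrite -/x in vN xN; rewrite DN xN RmE// -/x.
have -> : v *m ('D_x (nabla g X) y + nabla g X y *m connection_mx g y x - connection_mx g y x *m nabla g X y) =
   v *m 'D_x (nabla g X) y + v *m nabla g X y *m connection_mx g y x - x *m connection_mx g y v *m nabla g X y.
  by rewrite mulmxBr mulmxDr !mulmxA (connection_mx_sym x v Uy).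
rewrite DN vN (derive_comm v x oU Uy Xs).
move: ('D_x ('D_v X) y) ('D_v X y) ('D_x X y) (nabla g X y) (connection_mx g y v) (connection_mx g y x).
move: ('D_v _ y) ('D_x _ y) => Dv Dx DD a b N Gv Gx.
rewrite !(mulmxDl, mulmxBr, mulmxDr, mulmxA).
move: (x *m Dv) (x *m Dx) (a *m N) (x *m Gv *m N) (a *m Gx) (b *m Gv) (x *m Gx *m Gv) (x *m Gv *m Gx).
by move=> *; apply/rowP => k; rewrite !mxE; ring.
Qed.

(** The Leibniz rule for the function [<B a, b>]. Metric compatibility distributes the derivative of
    [g] over the covariant derivatives of the other factors, so that no connection term is left
    over. *)
Lemma derive_form y u a b B : smooth U a -> smooth U b -> smooth U B -> U y ->
  is_derive y u (fun z => a z *m B z *m g z *m (b z)^T)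
   ((cov g u a y *m B y + a y *m cov_endo g u B y) *m g y *m (b y)^T
   + a y *m B y *m g y *m (cov g u b y)^T).
Proof.
move=> sa sb sB Uy.
have := is_derive_mulmx (is_derive_mulmx (is_derive_mulmx (smooth_is_derive u sa Uy)
  (smooth_is_derive u sB Uy)) (smooth_is_derive u gs Uy))
  (is_derive_trmx (smooth_is_derive u sb Uy)).
rewrite metric_compatible// !covE cov_endoE; last exact: smooth_derivable Uy.
move: ('D_u a y) ('D_u b y) ('D_u B y) (connection_mx g y u) (g y) (a y) (b y) (B y) => da db dB Gu G ay by' By.
move=> H; apply: is_derive_eq; rewrite [(db + _)^T]linearD/= trmx_mul.
rewrite !(mulmxDl, mulmxBr, mulmxDr, mulmxA, mulNmx, mulmxN).
do ![match goal with |- context[?X *m by'^T] => move: (X *m by'^T) => ? end].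
do ![match goal with |- context[?X *m db^T] => move: (X *m db^T) => ? end].
by apply/matrixP => i j; rewrite !mxE; ring.
Qed.

Lemma form_symP (S : 'M[R]_n) :
  (forall v w : 'rV_n, (v *m S *m w^T) 0 0 = (w *m S *m v^T) 0 0) -> S^T = S.
Proof.
move=> H; apply/matrixP => i j; rewrite mxE.
have E k l : S k l = (basis_vec R k *m S *m (basis_vec R l)^T) 0 0.
  by rewrite /basis_vec -rowE trmx_delta -colE !mxE.
by rewrite !E.
Qed.

(** For [w] with constant components, the derivative of [<X, w>] along [u] is [<nabla_u X, w>] plus
    [<X, nabla_u w>]. The second term is symmetric in [u] and [w] by torsion-freeness, so closedness
    says exactly that the first is. *)
Lemma nabla_selfadjoint X y : smooth U X -> dual_form_closed g U X -> U y ->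
  (nabla g X y *m g y)^T = nabla g X y *m g y.
Proof.
move=> Xs Xc Uy; apply: form_symP => v w.
have D u0 w0 : 'D_u0 (fun z => ip (g z) (X z) w0) y =
    (u0 *m nabla g X y *m g y *m w0^T) 0 0 + (X y *m g y *m (u0 *m connection_mx g y w0)^T) 0 0.
  have sc : smooth U (fun _ : 'rV[R]_n => (1%:M : 'M[R]_n)) by exact: smooth_cst.
  have := derive_form u0 Xs (smooth_cst U w0) sc Uy.
  move/is_derive_mx => /(_ 0 0) [_].
  rewrite (_ : (fun z => _) = (fun z => ip (g z) (X z) w0)); last first.
    by apply/funext => z; rewrite mulmx1.
  move=> ->; rewrite cov_endoE; last exact: derivable_cst.
  rewrite derive_cst add0r !mulmx1 !mul1mx subrr mulmx0 addr0 cov_cstE.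
  by rewrite covE -nablaE// mxE (connection_mx_sym w0 u0 Uy).
by have := Xc y Uy v w; rewrite !D (connection_mx_sym v w Uy) !mulmxA => /addIr.
Qed.

(** * Conditions at a spatial maximum of the Rayleigh quotient *)

Section spatial_maximum.
Variables (A : 'rV[R]_n -> 'M[R]_n) (lam : R) (y v : 'rV[R]_n).
Hypothesis As : smooth U A.
Hypothesis Uy : U y.
Hypothesis Asym : (A y *m g y)^T = A y *m g y.
Hypothesis Amax : \forall z \near y, forall w, ip (g z) (w *m A z) w <= lam * ip (g z) w w.
Hypothesis Av : ip (g y) (v *m A y) v = lam * ip (g y) v v.

(** After the shift by the maximal value, the form of [B] is non-positive near [y] and vanishes at
    [v]. Derivatives can be taken of this form instead of a quotient. *)
Let B z := A z - lam%:M.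

Let Bs : smooth U B.
Proof. by apply: smoothB => //; exact: smooth_cst. Qed.

Let B_form z w : (w *m B z *m g z *m w^T) 0 0 = ip (g z) (w *m A z) w - lam * ip (g z) w w.
Proof.
rewrite /B mulmxBr mul_mx_scalar !mulmxBl -!scalemxAl /ip.
by rewrite mxE [X in _ + X]mxE [X in _ - X]mxE.
Qed.

Let B_max : \forall z \near y, forall w, (w *m B z *m g z *m w^T) 0 0 <= 0.
Proof. by apply: filterS Amax => z H w; rewrite B_form subr_le0. Qed.

Let Bg_sym : (B y *m g y)^T = B y *m g y.
Proof. by rewrite mulmxBl linearB/= Asym mul_scalar_mx linearZ/= gsym. Qed.

Lemma maximum_eigenvector : v *m A y = lam *: v.
Proof.
have : v *m B y *m g y = 0.
  rewrite -mulmxA; apply: nonpos_form_ker => //.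
    by move=> w; rewrite mulmxA; exact: (nbhs_singleton B_max).
  by rewrite mulmxA B_form Av subrr.
move=> /(congr1 (mulmx^~ (invmx (g y)))); rewrite mul0mx mulmxK ?metric_unit//.
by rewrite /B mulmxBr mul_mx_scalar => /eqP; rewrite subr_eq0 => /eqP.
Qed.

Let vB : v *m B y = 0.
Proof. by rewrite /B mulmxBr mul_mx_scalar maximum_eigenvector subrr. Qed.

Let Bgv w : w *m B y *m g y *m v^T = 0.
Proof.
rewrite -(mulmxA w) -Bg_sym trmx_mul mulmxA -!mulmxA -trmx_mul vB trmx0.
by rewrite !mulmx0.
Qed.

(** A constant multiple of the identity is parallel. *)
Let cov_B u z : U z -> cov_endo g u B z = cov_endo g u A z.
Proof.
move=> Uz; rewrite !cov_endoE; do ?exact: smooth_derivable Uz.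
have [_ ->] := is_deriveB (smooth_is_derive u As Uz) (is_derive_cst (lam%:M : 'M[R]_n) z u).
rewrite /B mulmxBr mulmxBl mul_mx_scalar mul_scalar_mx subr0.
by rewrite opprB !addrA subrK.
Qed.

(** Here [v] is extended with constant components; the terms that differentiate the extension vanish
    because [v] is in the kernel of [B y] from either side of the form. *)
Lemma maximum_first_order u : ip (g y) (v *m cov_endo g u A y) v = 0.
Proof.
pose p z := (v *m B z *m g z *m v^T) 0 0.
have sv := @smooth_cst R _ _ U v.
have sp : smooth U (fun z => v *m B z *m g z *m v^T).
  exact: (smooth_mulmx oU (smooth_mulmx oU (smooth_mulmx oU sv Bs) gs) (smooth_trmx oU sv)).
have p0 : p y = 0 by rewrite /p Bgv mxE.
have Dp : 'D_u p y = 0.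
  apply: (@derive_local_max _ _ U) => //; first exact: ((smooth_mxP _ oU).1 sp 0 0).
  by apply: filterS B_max => z Bz; rewrite p0; exact: Bz.
have := derive_form u sv sv Bs Uy; move/is_derive_mx => /(_ 0 0)[_].
rewrite -/p Dp vB cov_B//; move: (cov g u _ y) (cov_endo g u A y) => c C.
by rewrite /ip !mul0mx addr0 !mulmxDl Bgv add0r => <-.
Qed.

(** The bound is for an iterated derivative with [u] of constant components, not yet for the
    Hessian; the difference is a first-order term, which [maximum_laplacian] removes. *)
Lemma maximum_second_order u :
  ip (g y) (v *m cov_endo g u (fun z => cov_endo g u A z) y) v <= 0.
Proof.
(* w extends v with vanishing covariant derivative at y, by torsion-freeness. *)
pose w z := v - (z - y) *m connection_mx g y v.
have dw z : is_derive z u w (- (u *m connection_mx g y v)).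
  have H1 := is_derive_cst y z u.
  have H2 := is_derive_id z u.
  have H3 := is_derive_mulmx (is_deriveB H2 H1) (is_derive_cst (connection_mx g y v) z u).
  have := is_deriveB (is_derive_cst v z u) H3.
  by rewrite mulmx0 addr0 subr0 sub0r.
have sid : smooth U (fun z : 'rV[R]_n => z).
  case=> [|k]; first by split=> // z _; exact: cvg_id.
  split=> [z _|u0]; first exact: cvg_id.
  split=> [z _|]; first exact: derivable_id.
  apply: (@Ck_eq _ _ _ _ _ (fun=> u0)) => // [z _|]; last exact: Ck_cst.
  by rewrite derive_id.
have sw : smooth U w.
  apply: smoothB => //; first exact: smooth_cst.
  apply: smooth_mulmx => //; last exact: smooth_cst.
  by apply: smoothB => //; exact: smooth_cst.
have wy : w y = v by rewrite /w subrr mul0mx subr0.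
pose a z := cov g u w z.
have aE z : a z = - (u *m connection_mx g y v) + w z *m connection_mx g z u.
  by rewrite /a covE; have [_ ->] := dw z.
have ay : a y = 0 by rewrite aE wy (connection_mx_sym u v Uy) addNr.
have sa : smooth U a.
  apply: (@smooth_eq _ _ _ _ (fun z => - (u *m connection_mx g y v) + w z *m connection_mx g z u)) => //.
  apply: smoothD => //; first exact: smooth_cst.
  by apply: smooth_mulmx => //; exact: connection_mx_smooth.
pose C z := cov_endo g u A z.
have sC : smooth U C by exact: cov_endo_smooth.
pose p z := (w z *m B z *m g z *m (w z)^T) 0 0.
have sp : smooth U (fun z => w z *m B z *m g z *m (w z)^T).
  exact: (smooth_mulmx oU (smooth_mulmx oU (smooth_mulmx oU sw Bs) gs) (smooth_trmx oU sw)).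
have p0 : p y = 0 by rewrite /p wy Bgv mxE.
have : 'D_u ('D_u p) y <= 0.
  apply: (@derive2_local_max _ _ U) => //; first exact: ((smooth_mxP _ oU).1 sp 0 0).
  by apply: filterS B_max => z Bz; rewrite p0; exact: Bz.
(* The first derivative of [p], as given by [derive_form] near [y]. When it is differentiated once
   more at [y], every term containing [a y], [v *m B y] or the form of [B y] against [v] drops
   out. *)
pose q z := (a z *m B z *m g z *m (w z)^T + w z *m C z *m g z *m (w z)^T)
   + w z *m B z *m g z *m (a z)^T.
have -> : 'D_u ('D_u p) y = 'D_u (fun z => q z 0 0) y.
  apply: near_eq_derive; apply: filterS (open_nbhs_nbhs (conj oU Uy)) => z Uz.
  have /is_derive_mx/(_ 0 0)[_] := derive_form u sw sw Bs Uz.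
  rewrite -/p => ->; rewrite /q cov_B// -/(C z) -/(a z).
  by move: (a z) (C z) => a0 C0; rewrite !mulmxDl.
have dq := is_deriveD (is_deriveD (derive_form u sa sw Bs Uy) (derive_form u sw sw sC Uy))
  (derive_form u sw sa Bs Uy).
have /is_derive_mx/(_ 0 0)[_ ->] := dq.
rewrite -/(a y) -/(C y) -[fun z => cov_endo g u A z]/C wy ay trmx0 vB.
move: (cov g u a y) (cov_endo g u C y) (C y) => a0 C1 C0.
by rewrite !(mul0mx, mulmx0, addr0, add0r) Bgv add0r.
Qed.

(** The Hessian differs from the iterated derivative by a covariant derivative of [A], which
    [maximum_first_order] annihilates at [v]. The rest is the trace of the bilinear form [H],
    non-positive by [maximum_second_order]. *)
Lemma maximum_laplacian : ip (g y) (v *m rough_laplacian g A y) v <= 0.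
Proof.
pose C u z := cov_endo g u A z.
have sC u : smooth U (C u) by exact: cov_endo_smooth.
have CE u z : U z -> C u z = \sum_i u 0 i *: C (basis_vec R i) z.
  move=> Uz; rewrite /C cov_endoE; last exact: smooth_derivable Uz.
  rewrite (derive_rV u oU Uz As) (connection_mx_sum z u) mulmx_sumr mulmx_suml -big_split/= -sumrB.
  apply: eq_bigr => i _; rewrite cov_endoE; last exact: smooth_derivable Uz.
  by rewrite scalerBr scalerDr scalemxAr scalemxAl.
(* Bilinearity of the iterated derivative identifies the value of [H] on an arbitrary [w] with the
   second derivative along [w], for which the sign is known. *)
have C2E u1 u2 : cov_endo g u1 (C u2) y =
    \sum_i \sum_j (u1 0 i * u2 0 j) *: cov_endo g (basis_vec R i) (C (basis_vec R j)) y.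
  have dC u0 := smooth_is_derive u0 (sC u2) Uy.
  rewrite cov_endoE; last by have [] := dC u1.
  rewrite (derive_rV u1 oU Uy (sC u2)) (connection_mx_sum y u1) mulmx_sumr mulmx_suml -big_split/= -sumrB.
  apply: eq_bigr => i _.
  have -> : 'D_(basis_vec R i) (C u2) y =
      \sum_j u2 0 j *: 'D_(basis_vec R i) (C (basis_vec R j)) y.
    rewrite (near_eq_derive (g := fun z => \sum_j u2 0 j *: C (basis_vec R j) z)); last first.
      by apply: filterS (open_nbhs_nbhs (conj oU Uy)) => z; exact: CE.
    rewrite (_ : (fun z => _) = \sum_j (u2 0 j \*: C (basis_vec R j))); last first.
      by apply/funext => z; rewrite fct_sumE.
    rewrite derive_sum; last by move=> j; apply: derivableZ; exact: smooth_derivable Uy.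
    by apply: eq_bigr => j _; rewrite deriveZ//; exact: smooth_derivable Uy.
  rewrite CE// -scalemxAr -scalemxAl -scalerDr -scalerBr mulmx_suml mulmx_sumr.
  rewrite -big_split/= -sumrB scaler_sumr; apply: eq_bigr => j _.
  have dCj := smooth_derivable (v := basis_vec R i) (sC (basis_vec R j)) Uy.
  rewrite -scalerA (cov_endoE dCj); congr (_ *: _).
  by rewrite scalerBr scalerDr scalemxAl -scalemxAr.
pose H := \matrix_(i, j) ip (g y) (v *m cov_endo g (basis_vec R i) (C (basis_vec R j)) y) v.
have -> : ip (g y) (v *m rough_laplacian g A y) v = \sum_i \sum_j invmx (g y) i j * H i j.
  rewrite /rough_laplacian /ip mulmx_sumr !mulmx_suml summxE; apply: eq_bigr => i _.
  rewrite mulmx_sumr !mulmx_suml summxE; apply: eq_bigr => j _.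
  rewrite -scalemxAr -!scalemxAl mxE; congr (_ * _).
  have := maximum_first_order (cov g (basis_vec R i) (cst (basis_vec R j)) y).
  rewrite /hess_endo /ip mulmxBr !mulmxBl [X in X = 0 -> _]/= => H0.
  by rewrite mxE [X in _ + X]mxE H0 subr0 [RHS]mxE.
apply: trace_posdef_nonpos.
- exact: gsym.
- by move=> w w0; exact: gpos.
- move=> w; apply: le_trans (maximum_second_order w); rewrite le_eqVlt; apply/orP; left.
  rewrite (_ : cov_endo g w _ y = cov_endo g w (C w) y)// C2E /ip mulmx_sumr !mulmx_suml summxE.
  rewrite mxE; under eq_bigr do rewrite mxE mulr_suml.
  rewrite exchange_big/=; apply/eqP; apply: eq_bigr => i _.
  rewrite mulmx_sumr !mulmx_suml summxE; apply: eq_bigr => j _.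
  rewrite -scalemxAr -!scalemxAl [RHS]mxE [w^T j 0]mxE [H i j]mxE /ip; move: (_ 0 0) => r; ring.
Qed.

End spatial_maximum.

End connection.

(** * Invariance under change of charts *)

Section invariance.
Context {R : realType} {n : nat}.
Implicit Types (y u v w : 'rV[R]_n).

(* The right-hand side is half the Lie derivative of the metric along X, which
   contains no Christoffel symbol: its behaviour under a change of charts only
   requires the chain rule and the symmetry of second derivatives. *)
Lemma nabla_form (g : 'rV[R]_n -> 'M[R]_n) U X y v :
  open U -> smooth U g -> (forall y, U y -> (g y)^T = g y) ->
  (forall y, U y -> forall v, v != 0 -> 0 < ip (g y) v v) ->
  smooth U X -> U y ->
  ip (g y) (v *m nabla g X y) v =
  ('D_v X y *m g y *m v^T) 0 0 + 2^-1 * (v *m 'D_(X y) g y *m v^T) 0 0.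
Proof.
move=> oU gs gsym gpos Xs Uy.
rewrite (nablaE g oU v Xs Uy) (connection_mx_sym oU gs gsym v (X y) Uy).
rewrite (metric_compatible oU gs gsym gpos (X y) Uy) /ip.
move: ('D_v X y) (connection_mx g y (X y)) => dX G.
rewrite mulmxDr !mulmxDl !mulmxA [LHS]mxE; congr (_ + _).
rewrite [X in _ = _ * X]mxE.
have -> : (v *m g y *m G^T *m v^T) 0 0 = (v *m G *m g y *m v^T) 0 0.
  have -> : v *m g y *m G^T *m v^T = (v *m G *m g y *m v^T)^T.
    by rewrite !trmx_mul trmxK gsym// !mulmxA.
  by rewrite mxE.
by move: (_ 0 0) => r; field.
Qed.

Variables (O Ui Uj : set 'rV[R]_n) (phi : 'rV[R]_n -> 'rV[R]_n)
  (gi gj : 'rV[R]_n -> 'M[R]_n) (Xi Xj : 'rV[R]_n -> 'rV[R]_n).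
Hypotheses (oO : open O) (oUi : open Ui) (oUj : open Uj).
Hypotheses (OUi : O `<=` Ui) (OUj : forall y, O y -> Uj (phi y)).
Hypothesis phis : smooth O phi.
Hypotheses (gis : smooth Ui gi) (gisym : forall y, Ui y -> (gi y)^T = gi y)
  (gipos : forall y, Ui y -> forall v, v != 0 -> 0 < ip (gi y) v v).
Hypotheses (gjs : smooth Uj gj) (gjsym : forall y, Uj y -> (gj y)^T = gj y)
  (gjpos : forall y, Uj y -> forall v, v != 0 -> 0 < ip (gj y) v v).
Hypotheses (Xis : smooth Ui Xi) (Xjs : smooth Uj Xj).
Hypothesis gij : forall y, O y -> forall v w,
  ip (gj (phi y)) ('D_v phi y) ('D_w phi y) = ip (gi y) v w.
Hypothesis Xij : forall y, O y -> Xj (phi y) = 'D_(Xi y) phi y.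

Let J z : 'M[R]_n := \matrix_(i < n) 'D_(basis_vec R i) phi z.

Let JE v z : O z -> v *m J z = 'D_v phi z.
Proof.
move=> Oz; rewrite (derive_rV v oO Oz phis) mulmx_sum_row.
by apply: eq_bigr => i _; rewrite rowK.
Qed.

Let Js : smooth O J.
Proof.
apply/smooth_mxP => // i j.
have := smooth_derive (basis_vec R i) phis; move/(smooth_mxP _ oO) => /(_ 0 j).
by apply: smooth_eq => // z _; rewrite [RHS]mxE.
Qed.

(** The second derivatives of [phi] enter once through the derivative of [Xj] and twice, with factor
    one half, through the derivative of the metric; these contributions agree. *)
Lemma nabla_form_invariant y v : O y ->
  ip (gj (phi y)) ('D_v phi y *m nabla gj Xj (phi y)) ('D_v phi y) =
  ip (gi y) (v *m nabla gi Xi y) v.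
Proof.
move=> Oy; have Uiy := OUi Oy; have Ujy := OUj Oy.
rewrite (nabla_form _ oUi gis gisym gipos Xis Uiy).
rewrite (nabla_form _ oUj gjs gjsym gjpos Xjs Ujy) Xij//.
set x := Xi y.
have giE z : O z -> gi z = J z *m gj (phi z) *m (J z)^T.
  move=> Oz; apply/matrixP => k l.
  have := gij Oz (basis_vec R k) (basis_vec R l); rewrite -!JE// /ip trmx_mul !mulmxA.
  have E (S : 'M[R]_n) : (basis_vec R k *m S *m (basis_vec R l)^T) 0 0 = S k l.
    by rewrite /basis_vec -rowE trmx_delta -colE !mxE.
  by rewrite -(E (gi z)) -(E (_ *m _)) !mulmxA => <-.
have dphi u : is_derive y u phi ('D_u phi y) by exact: smooth_is_derive Oy.
have dJ u : is_derive y u J ('D_u J y) by exact: smooth_is_derive Oy.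
have nO : \near y, O y by exact: open_nbhs_nbhs.
have D1 : 'D_x gi y = 'D_x J y *m gj (phi y) *m (J y)^T
   + J y *m 'D_('D_x phi y) gj (phi y) *m (J y)^T + J y *m gj (phi y) *m ('D_x J y)^T.
  rewrite (near_eq_derive (g := fun z => J z *m gj (phi z) *m (J z)^T)); last first.
    by apply: filterS nO => z; exact: giE.
  have [_ ->] := is_derive_mulmx (is_derive_mulmx (dJ x)
    (is_derive_comp_mx oUj Ujy gjs (dphi x))) (is_derive_trmx (dJ x)).
  by rewrite mulmxDl.
have D2 : 'D_('D_v phi y) Xj (phi y) = 'D_v Xi y *m J y + x *m 'D_v J y.
  have [_ <-] := is_derive_comp_mx oUj Ujy Xjs (dphi v).
  rewrite (near_eq_derive (g := fun z => Xi z *m J z)); last first.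
    by apply: filterS nO => z Oz; rewrite Xij// JE.
  by have [_ ->] := is_derive_mulmx (smooth_is_derive v Xis Uiy) (dJ v).
(* Both sides are the mixed second derivative of [phi] along [x] and [v]. *)
have D3 : x *m 'D_v J y = v *m 'D_x J y.
  have DD u1 u2 : u1 *m 'D_u2 J y = 'D_u2 ('D_u1 phi) y.
    have [_ <-] := cst_mulmx_is_derive u1 (dJ u2).
    by apply: near_eq_derive; apply: filterS nO => z Oz; rewrite JE.
  by rewrite !DD; exact: (derive_comm _ _ oO Oy phis).
have giy := giE _ Oy.
rewrite D2 D3 D1 giy -(JE v Oy) !trmx_mul.
have Gs := gjsym Ujy; move: (gj (phi y)) Gs ('D_('D_x phi y) gj (phi y)) => G Gs P.
move: (J y) ('D_v Xi y) ('D_x J y) => Jy a K.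
rewrite !(mulmxDl, mulmxDr, mulmxA).
have S : (v *m Jy *m G *m K^T *m v^T) 0 0 = (v *m K *m G *m Jy^T *m v^T) 0 0.
  have -> : v *m Jy *m G *m K^T *m v^T = (v *m K *m G *m Jy^T *m v^T)^T.
    by rewrite !trmx_mul !trmxK Gs !mulmxA.
  by rewrite mxE.
have addE (A B : 'M[R]_1) : (A + B) 0 0 = A 0 0 + B 0 0 by rewrite mxE.
rewrite !addE S.
move: (_ 0 0) (_ 0 0) (_ 0 0) => r1 r2 r3; by field.
Qed.

End invariance.

Section overlap.
Context {R : realType} {n : nat} {M : topologicalType}.

Lemma overlap_open (c d : chart R n M) :
  open (chart_coord c @` (cdom c `&` cdom d)).
Proof.
rewrite openE => y [x [cx dx] <-]; rewrite /interior.
have cy : ccodom c (chart_coord c x) by exists x.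
have n1 : nbhs (chart_coord c x) (ccodom c).
  by apply: open_nbhs_nbhs; split=> //; exact: ccodom_open.
have n2 : nbhs (chart_coord c x) (chart_param c @^-1` (cdom c `&` cdom d)).
  apply: (chart_param_continuous cy); rewrite chart_coordK//.
  apply: open_nbhs_nbhs; split=> //.
  by apply: openI; exact: cdom_open.
apply: filterS (filterI n1 n2) => z [[x' cx' <-]]; rewrite /= chart_coordK// => -[_ dx'].
by exists x'.
Qed.

End overlap.

(** * Time-dependent vector fields *)

Section slices.
Context {R : realType} {n : nat} {F : normedModType R}.
Local Notation E := 'rV[R]_n.
Local Notation E2 := (R^o * 'rV[R]_n)%type.
Implicit Types (V : set E2) (G : E2 -> F).

Let pairE (h s t : R) (v y : E) : h *: ((s : R^o), v) + ((t : R^o), y) = (h * s + t, h *: v + y).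
Proof. by []. Qed.

Lemma pair_continuous_snd (t : R) : continuous (fun y : E => ((t : R^o), y)).
Proof.
move=> y.
have c1 : ((fun=> t : R^o) : E -> R^o) @ y --> (t : R^o) by apply: cvg_cst; exact: nbhs_filter.
have c2 := cvg_pair c1 (@cvg_id _ (nbhs y)); exact: c2.
Qed.

Lemma pair_continuous_fst (y : E) : continuous (fun t : R => ((t : R^o), y)).
Proof.
move=> t.
have c1 : ((fun=> y) : R -> E) @ t --> y by apply: cvg_cst; exact: nbhs_filter.
have c2 := cvg_pair (@cvg_id _ (nbhs (t : R^o))) c1; exact: c2.
Qed.

Lemma derive_snd G (t : R) (y v : E) :
  'D_v (fun y => G ((t : R^o), y)) y = 'D_((0 : R^o), v) G ((t : R^o), y).
Proof.
have eqf : (fun h : R => h^-1 *: (((fun y => G ((t : R^o), y)) \o shift y) (h *: v) - G ((t : R^o), y)))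
   = (fun h : R => h^-1 *: ((G \o shift ((t : R^o), y)) (h *: ((0 : R^o), v)) - G ((t : R^o), y))).
  by apply/funext => h /=; rewrite pairE mulr0 add0r.
by rewrite /derive eqf.
Qed.

Lemma derivable_snd G (t : R) (y v : E) :
  derivable G ((t : R^o), y) ((0 : R^o), v) -> derivable (fun y => G ((t : R^o), y)) y v.
Proof.
have eqf : (fun h : R => h^-1 *: (((fun y => G ((t : R^o), y)) \o shift y) (h *: v) - G ((t : R^o), y)))
   = (fun h : R => h^-1 *: ((G \o shift ((t : R^o), y)) (h *: ((0 : R^o), v)) - G ((t : R^o), y))).
  by apply/funext => h /=; rewrite pairE mulr0 add0r.
by rewrite /derivable eqf.
Qed.

Lemma is_derive_fst G (t : R) (y : E) :
  derivable G ((t : R^o), y) ((1 : R^o), 0) ->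
  is_derive t (1 : R) (fun s : R => G ((s : R^o), y)) ('D_((1 : R^o), 0) G ((t : R^o), y)).
Proof.
have eqf : (fun h : R => h^-1 *: (((fun s : R => G ((s : R^o), y)) \o shift t) (h *: (1 : R)) - G ((t : R^o), y)))
   = (fun h : R => h^-1 *: ((G \o shift ((t : R^o), y)) (h *: ((1 : R^o), 0)) - G ((t : R^o), y))).
  by apply/funext => h /=; rewrite pairE scaler0 add0r mulr1 [h%:A]mulr1.
by move=> dG; split; rewrite /derivable /derive eqf.
Qed.

Lemma Ck_snd k V G (t : R) : Ck k V G ->
  Ck k (fun y => V ((t : R^o), y)) (fun y => G ((t : R^o), y)).
Proof.
elim: k G => [|k IH] G [Gc Gd].
  split=> // y Vy; apply: (@cvg_comp _ _ _ _ G _ (nbhs ((t : R^o), y))); last exact: (Gc _ Vy).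
  exact: pair_continuous_snd.
split=> [y Vy|v].
  apply: (@cvg_comp _ _ _ _ G _ (nbhs ((t : R^o), y))); last exact: (Gc _ Vy).
  exact: pair_continuous_snd.
have [Gv Gk] := Gd ((0 : R^o), v); split=> [y Vy|].
  by apply: derivable_snd; exact: Gv.
rewrite (_ : (fun y => _) = (fun y => 'D_((0 : R^o), v) G ((t : R^o), y))); first exact: (IH _ Gk).
by apply/funext => y; rewrite derive_snd.
Qed.

Lemma smooth_snd V G (t : R) : smooth V G ->
  smooth (fun y => V ((t : R^o), y)) (fun y => G ((t : R^o), y)).
Proof. by move=> sG k; exact: Ck_snd. Qed.

Lemma open_snd V (t : R) : open V -> open (fun y => V ((t : R^o), y)).
Proof.
move=> oV; rewrite openE => y Vy; apply: (@pair_continuous_snd t y).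
exact: open_nbhs_nbhs.
Qed.

(** The extensions exist only locally, so the smoothness of a time slice is assembled by [Ck_local]
    from neighbourhoods on which it coincides with the slice of one extension. *)
Lemma tsmooth_smooth (T : \bar R) (U : set E) (f : R -> E -> F) t :
  open U -> tsmooth T U f -> time_in T t -> smooth U (f t).
Proof.
move=> oU fs tT k; apply: Ck_local => y Uy.
have [V [G [oV Vty sG fG]]] := fs t y tT Uy.
exists (U `&` (fun y => V ((t : R^o), y))); split=> //.
apply: (@Ck_eq _ _ _ _ _ (fun y => G ((t : R^o), y))).
- by apply: openI => //; exact: open_snd.
- by move=> z [Uz Vz]; rewrite fG.
- apply: Ck_sub (smooth_snd t sG k); by move=> z [].
Qed.

End slices.

Section time_dependent.
Context {R : realType} {n : nat}.
Local Notation E := 'rV[R]_n.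
Variables (g : 'rV[R]_n -> 'M[R]_n) (U : set 'rV[R]_n) (T : \bar R)
  (X : R -> 'rV[R]_n -> 'rV[R]_n).
Hypothesis oU : open U.
Hypothesis gs : smooth U g.
Hypothesis gsym : forall y, U y -> (g y)^T = g y.
Hypothesis gpos : forall y, U y -> forall v, v != 0 -> 0 < ip (g y) v v.
Hypothesis Xs : tsmooth T U X.

Lemma nbhs_snd (V : set (R^o * 'rV[R]_n)%type) (t : R) (y : E) : nbhs ((t : R^o), y) V ->
  \forall z \near y, V ((t : R^o), z).
Proof. exact: pair_continuous_snd. Qed.

Lemma nbhs_fst (V : set (R^o * 'rV[R]_n)%type) (t : R) (y : E) : nbhs ((t : R^o), y) V ->
  \forall s \near t, V ((s : R^o), y).
Proof. exact: pair_continuous_fst. Qed.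

Lemma time_in_near (t : R) : 0 < t -> (t%:E < T)%E -> \forall s \near t, time_in T s.
Proof.
move=> t0 tT; have h1 : nbhs t [set s : R | 0 < s] by apply: open_nbhs_nbhs; split=> //; exact: open_gt.
suff h2 : \forall s \near t, (s%:E < T)%E.
  by apply: filterS2 h1 h2 => s s0 sT; split=> //; exact: ltW.
case: T tT => [r||] tr.
- rewrite lte_fin in tr; have h3 := lt_nbhsl tr.
  by apply: filterS h3 => s; rewrite /= lte_fin.
- by apply: filterE => s; rewrite ltry.
- by [].
Qed.

(** The right-hand side makes sense on a full space-time neighbourhood, even for [t0 = 0]. It yields
    both the joint continuity of [nabla g (X s)] in time and space and its time derivative. *)
Lemma nabla_extension t0 y0 : time_in T t0 -> U y0 ->
  exists V (G : (R^o * 'rV[R]_n)%type -> 'rV[R]_n),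
  [/\ open V, V ((t0 : R^o), y0), smooth V G &
   forall s y, time_in T s -> U y -> V ((s : R^o), y) ->
     X s y = G ((s : R^o), y) /\
     forall v, v *m nabla g (X s) y =
      'D_((0 : R^o), v) G ((s : R^o), y) + G ((s : R^o), y) *m connection_mx g y v].
Proof.
move=> tT Uy0; have [V [G [oV Vty sG fG]]] := Xs tT Uy0.
exists V, G; split=> // s y sT Uy Vsy; split; first exact: fG.
move=> v; rewrite (nablaE g oU v (tsmooth_smooth oU Xs sT) Uy) fG// -derive_snd.
congr (_ + _); apply: near_eq_derive.
have nV : \forall z \near y, V ((s : R^o), z).
  by apply: nbhs_snd; exact: open_nbhs_nbhs.
by apply: filterS2 (open_nbhs_nbhs (conj oU Uy)) nV => z Uz Vz; exact: fG.
Qed.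

Lemma dot_eq (f : R -> E) (t : R) d : is_derive t (1 : R) f d -> dot f t = d.
Proof.
move=> [fd <-]; apply: cvg_lim => //.
apply: (@cvg_dnbhs_at_right R _ (fun h : R => h^-1 *: (f (t + h) - f t)) 0 ('D_1 f t)).
have : h^-1 *: ((f \o shift t) (h *: (1 : R)) - f t) @[h --> (0 : R)^'] --> 'D_1 f t by exact: fd.
rewrite (_ : (fun h : R => h^-1 *: ((f \o shift t) (h *: (1 : R)) - f t)) =
   (fun h : R => h^-1 *: (f (t + h) - f t)))//.
by apply/funext => h /=; rewrite [h%:A]mulr1 (addrC t).
Qed.

Lemma dot_derivable t y v : 0 < t -> (t%:E < T)%E -> U y ->
  derivable (fun z => dot (fun s => X s z) t) y v.
Proof.
move=> t0 tT Uy; have tin : time_in T t by split; [exact: ltW|].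
have [V [G [oV Vty sG fG]]] := Xs tin Uy.
have nT := time_in_near t0 tT.
have sG1 := smooth_derive ((1 : R^o), 0) sG.
have := derivable_snd (smooth_derivable (v := ((0 : R^o), v)) sG1 Vty).
apply: near_eq_derivable.
have nVy : \forall z \near y, V ((t : R^o), z) by apply: nbhs_snd; exact: open_nbhs_nbhs.
apply: filterS2 (open_nbhs_nbhs (conj oU Uy)) nVy => z Uz Vz; apply/esym/dot_eq.
apply: (near_eq_is_derive _ (is_derive_fst (smooth_derivable (v := ((1 : R^o), 0)) sG Vz))).
have nV : \forall s \near t, V ((s : R^o), z) by apply: nbhs_fst; exact: open_nbhs_nbhs.
by apply: filterS2 nT nV => s sT Vs; rewrite fG.
Qed.

(** The connection and the metric are independent of time, and the mixed derivatives of the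
    extension commute, so the time derivative passes through the covariant one. *)
Lemma is_derive_nabla_time t y v : 0 < t -> (t%:E < T)%E -> U y ->
  is_derive t (1 : R) (fun s : R => ip (g y) (v *m nabla g (X s) y) v)
    (ip (g y) (cov g v (fun z => dot (fun s => X s z) t) y) v).
Proof.
move=> t0 tT Uy; have tin : time_in T t by split; [exact: ltW|].
have [V [G [oV Vty sG fG]]] := nabla_extension tin Uy.
have nT := time_in_near t0 tT.
have dG z : V ((t : R^o), z) -> is_derive t (1 : R) (fun s : R => G ((s : R^o), z))
    ('D_((1 : R^o), 0) G ((t : R^o), z)).
  by move=> Vz; apply: is_derive_fst; exact: smooth_derivable Vz.
have dotX z : U z -> V ((t : R^o), z) ->
    dot (fun s => X s z) t = 'D_((1 : R^o), 0) G ((t : R^o), z).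
  move=> Uz Vz; apply: dot_eq; apply: near_eq_is_derive (dG z Vz).
  have nV : \forall s \near t, V ((s : R^o), z) by apply: nbhs_fst; exact: open_nbhs_nbhs.
  by apply: filterS2 nT nV => s sT Vs; rewrite (fG s z sT Uz Vs).1.
have nVy : \forall z \near y, V ((t : R^o), z) by apply: nbhs_snd; exact: open_nbhs_nbhs.
have nVt : \forall s \near t, V ((s : R^o), y) by apply: nbhs_fst; exact: open_nbhs_nbhs.
rewrite covE dotX//.
have -> : 'D_v (fun z => dot (fun s => X s z) t) y =
    'D_((0 : R^o), v) ('D_((1 : R^o), 0) G) ((t : R^o), y).
  rewrite -derive_snd; apply: near_eq_derive.
  by apply: filterS2 (open_nbhs_nbhs (conj oU Uy)) nVy => z; exact: dotX.
rewrite (derive_comm _ _ oV Vty sG).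
have sG0 := smooth_derive ((0 : R^o), v) sG.
have d1 := is_derive_fst (smooth_derivable (v := ((1 : R^o), 0)) sG0 Vty).
have d2 := is_derive_mulmx (dG y Vty) (is_derive_cst (connection_mx g y v) t 1).
have d3 := is_derive_mulmx (is_deriveD d1 d2) (is_derive_cst (g y *m v^T) t 1).
have /is_derive_mx/(_ 0 0) d4 := d3.
rewrite mulmx0 addr0 in d4; rewrite mulmx0 addr0 mulmxA in d4.
apply: near_eq_is_derive d4.
apply: filterS2 nT nVt => s sT Vs; rewrite /ip (fG s y sT Uy Vs).2.
by rewrite mulmxA.
Qed.

End time_dependent.

(** * Maxima of Rayleigh quotients *)

(* A multivalued form of the extreme value theorem for upper semicontinuous
   functions: val p is the set of values over p, as in a unit sphere bundle that
   has no ready-made topology. *)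
Lemma compact_attains_max (R : realType) (P : topologicalType) (B : set P) (val : P -> R -> Prop) :
  compact B -> B !=set0 ->
  (forall p, B p -> exists2 r, val p r &
     forall c, r < c -> \forall q \near p, B q -> forall s, val q s -> s < c) ->
  exists p r, [/\ B p, val p r & forall q s, B q -> val q s -> s <= r].
Proof.
move=> cB [p0 Bp0] Hval.
(* The value chosen over [p] is the largest one there, since semicontinuity also applies at [p]
   itself; [0] is a default outside [B]. *)
have [rho rhoP] : exists rho : P -> R, forall p, B p -> val p (rho p) /\
     forall c, rho p < c -> \forall q \near p, B q -> forall s, val q s -> s < c.
  have H p : exists r, B p -> val p r /\
     forall c, r < c -> \forall q \near p, B q -> forall s, val q s -> s < c.
    have [Bp|nBp] := pselect (B p); last by exists 0 => /nBp.
    by have [r vr rP] := Hval p Bp; exists r.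
  by exists (fun p => sval (cid (H p))) => p; exact: (svalP (cid (H p))).
have rho_max p s : B p -> val p s -> s <= rho p.
  move=> Bp ps; rewrite leNgt; apply/negP => rs.
  have [_ /(_ s rs) /nbhs_singleton/(_ Bp s ps)] := rhoP p Bp.
  by rewrite ltxx.
apply: contrapT => nmax.
have bigger p : B p -> exists2 q, B q & rho p < rho q.
  move=> Bp; apply: contrapT => H; apply: nmax; exists p, (rho p); split=> //.
    by have [] := rhoP p Bp.
  move=> q s Bq qs; apply: le_trans (rho_max q s Bq qs) _; rewrite leNgt.
  by apply/negP => pq; apply: H; exists q.
(* The superlevel sets of [rho] form a proper filter. At a cluster point [x] some [q] has a larger
   value, yet near [x] all values stay below [rho q], so this neighbourhood misses a superlevel
   set. *)
pose G := filter_from B (fun q => [set p | B p /\ rho q <= rho p]).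
have FG : Filter G.
  apply: filter_from_filter; first by exists p0.
  move=> p q Bp Bq; case: (leP (rho p) (rho q)) => pq.
    by exists q => // z [Bz qz]; split; split=> //; exact: le_trans qz.
  by exists p => // z [Bz qz]; split; split=> //; exact: le_trans (ltW pq) qz.
have PG : ProperFilter G.
  by apply: filter_from_proper => p Bp; exists p; split.
have GB : G B by exists p0 => // z [].
have [x [Bx clx]] := cB G PG GB.
have [q Bq xq] := bigger x Bx.
have [_ /(_ _ xq) nx] := rhoP x Bx.
have Gq : G [set p | B p /\ rho q <= rho p] by exists q.
have [z [[Bz qz] zlt]] := clx _ _ Gq nx.
have [vz _] := rhoP z Bz.
by have := zlt Bz _ vz; rewrite ltNge qz.
Qed.

Section forms_on_sphere.
Context {R : realType} {n : nat}.
Implicit Types (S G : 'M[R]_n) (v : 'rV[R]_n).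

Definition form_quotient S G v : R := (v *m S *m v^T) 0 0 / (v *m G *m v^T) 0 0.

Lemma form_quotientZ S G c v : c != 0 -> form_quotient S G (c *: v) = form_quotient S G v.
Proof.
move=> c0; have E A : (c *: v *m A *m (c *: v)^T) 0 0 = c ^+ 2 * (v *m A *m v^T) 0 0.
  rewrite [(c *: v)^T]linearZ/= -!scalemxAl -scalemxAr scalerA mxE.
  by rewrite expr2.
rewrite /form_quotient !E invfM mulrACA mulfV ?mul1r//.
by rewrite expf_neq0.
Qed.

Lemma cvg_mulmx (m p q : nat) (T : Type) (F : set_system T) (f : T -> 'M[R]_(m, p))
    (g : T -> 'M[R]_(p, q)) (a : 'M[R]_(m, p)) (b : 'M[R]_(p, q)) : Filter F ->
  f x @[x --> F] --> a -> g x @[x --> F] --> b -> f x *m g x @[x --> F] --> a *m b.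
Proof.
move=> FF /cvg_mxP fa /cvg_mxP gb; apply/cvg_mxP => i j; rewrite mxE.
have -> : (fun x => (f x *m g x) i j) = (fun x => \sum_k f x i k * g x k j).
  by apply/funext => x; rewrite mxE.
by apply: cvg_sum => k _; apply: cvgM; [exact: fa|exact: gb].
Qed.

Lemma cvg_form (T : Type) (F : set_system T) (S : T -> 'M[R]_n) (v : T -> 'rV[R]_n)
    (S0 : 'M[R]_n) (v0 : 'rV[R]_n) :
  Filter F -> S x @[x --> F] --> S0 -> v x @[x --> F] --> v0 ->
  (v x *m S x *m (v x)^T) 0 0 @[x --> F] --> (v0 *m S0 *m v0^T) 0 0.
Proof.
move=> FF SS vv.
have vT : (v x)^T @[x --> F] --> v0^T.
  apply/cvg_mxP => i j; rewrite mxE.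
  have -> : (fun x => (v x)^T i j) = (fun x => v x j i) by apply/funext => x; rewrite mxE.
  by move/cvg_mxP : vv; apply.
by have /cvg_mxP := cvg_mulmx FF (cvg_mulmx FF vv SS) vT; apply.
Qed.

Lemma cvg_form_quotient (T : Type) (F : set_system T) (S G : T -> 'M[R]_n) (v : T -> 'rV[R]_n)
    (S0 G0 : 'M[R]_n) (v0 : 'rV[R]_n) :
  Filter F -> S x @[x --> F] --> S0 -> G x @[x --> F] --> G0 -> v x @[x --> F] --> v0 ->
  (v0 *m G0 *m v0^T) 0 0 != 0 ->
  form_quotient (S x) (G x) (v x) @[x --> F] --> form_quotient S0 G0 v0.
Proof.
move=> FF SS GG vv G0v; apply: cvgM; first exact: cvg_form.
by apply: cvgV => //; exact: cvg_form.
Qed.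

(** The quotient is homogeneous of degree zero, so the metric sphere, which varies with the point,
    can be replaced by the fixed unit sphere [K] of the coordinate norm. Compactness of [K] gives
    the maximising vector, and a tube argument makes the upper bound uniform in [v]. *)
Lemma form_quotient_usc (T : Type) (F : set_system T) (S G : T -> 'M[R]_n) (a b : T -> R)
    (S0 G0 : 'M[R]_n) (a0 b0 : R) : Filter F ->
  S x @[x --> F] --> S0 -> G x @[x --> F] --> G0 ->
  a x @[x --> F] --> a0 -> b x @[x --> F] --> b0 ->
  (forall v, v != 0 -> 0 < ip G0 v v) -> (exists v : 'rV[R]_n, v != 0) ->
  exists2 v0 : 'rV[R]_n, v0 != 0 & forall c, a0 * form_quotient S0 G0 v0 + b0 < c ->
    \forall x \near F, forall v, v != 0 -> a x * form_quotient (S x) (G x) v + b x < c.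
Proof.
move=> FF SS GG aa bb Gpos [w w0].
pose K : set 'rV[R]_n := [set v | `|v| = 1].
have normed v : v != 0 -> K (`|v|^-1 *: v).
  by move=> v0; rewrite /K/= normrZ normfV normr_id mulVf// normr_eq0.
have Kn0 v : K v -> v != 0.
  by rewrite /K/=; apply: contra_eq_neq => ->; rewrite normr0 eq_sym oner_neq0.
have cK : compact K.
  apply: bounded_closed_compact.
    by exists 1; split; [exact: num_real|move=> c c1 v /= ->; exact: ltW].
  rewrite (_ : K = (fun v => `|v|) @^-1` [set 1])//.
  apply: closed_comp; last exact: closed_eq.
  by move=> v _; exact: norm_continuous.
have Gn0 v : v != 0 -> (v *m G0 *m v^T) 0 0 != 0 by move=> v0; rewrite gt_eqF// Gpos.
pose f v := a0 * form_quotient S0 G0 v + b0.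
have cf : {within K, continuous f}.
  apply: continuous_in_subspaceT => v /set_mem Kv.
  have Fv := nbhs_filter v.
  have cS : (fun=> S0) v' @[v' --> v] --> S0 by apply: cvg_cst.
  have cG : (fun=> G0) v' @[v' --> v] --> G0 by apply: cvg_cst.
  have ca : (fun=> a0) v' @[v' --> v] --> a0 by apply: cvg_cst.
  have cb : (fun=> b0) v' @[v' --> v] --> b0 by apply: cvg_cst.
  exact: (cvgD (cvgM ca (cvg_form_quotient Fv cS cG (@cvg_id _ (nbhs v)) (Gn0 _ (Kn0 _ Kv)))) cb).
have [v0 /set_mem Kv0 v0max] := EVT_max_rV (ex_intro _ _ (normed _ w0)) cK cf.
exists v0; first exact: Kn0.
move=> c v0c.
have /compact_near_coveringP/(_ _ F (fun x v => a x * form_quotient (S x) (G x) v + b x < c) FF) := cK.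
have Hcov v : K v -> \forall v' \near v & x \near F, a x * form_quotient (S x) (G x) v' + b x < c.
  move=> Kv.
  have c2 : (fun z : 'rV[R]_n * T => a z.2 * form_quotient (S z.2) (G z.2) z.1 + b z.2)
     @ filter_prod (nbhs v) F --> f v.
    have FP : Filter (filter_prod (nbhs v) F) by exact: filter_prod_filter.
    have Fsnd : (@snd 'rV[R]_n T) @ filter_prod (nbhs v) F --> F by exact: cvg_snd.
    have Ffst : (@fst 'rV[R]_n T) @ filter_prod (nbhs v) F --> v by exact: cvg_fst.
    have a2 := @cvg_comp _ _ _ (@snd 'rV[R]_n T) a _ F _ Fsnd aa.
    have b2 := @cvg_comp _ _ _ (@snd 'rV[R]_n T) b _ F _ Fsnd bb.
    have S2 := @cvg_comp _ _ _ (@snd 'rV[R]_n T) S _ F _ Fsnd SS.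
    have G2 := @cvg_comp _ _ _ (@snd 'rV[R]_n T) G _ F _ Fsnd GG.
    exact: (cvgD (cvgM a2 (cvg_form_quotient FP S2 G2 Ffst (Gn0 _ (Kn0 _ Kv)))) b2).
  have fc : f v < c by apply: le_lt_trans v0c; apply: v0max; exact/mem_set.
  exact: (c2 _ (lt_nbhsl fc)).
move=> /(_ Hcov); apply: filterS => x H v vn0.
have := H _ (normed _ vn0); rewrite form_quotientZ// invr_eq0 normr_eq0//.
Qed.

End forms_on_sphere.

Definition rayleigh (R : realType) (n : nat) (g : 'rV[R]_n -> 'M[R]_n)
    (Z : 'rV[R]_n -> 'rV[R]_n) (y v : 'rV[R]_n) : R :=
  ip (g y) (v *m nabla g Z y) v / ip (g y) v v.

Section rayleigh_maximum.
Context {R : realType} {n : nat}.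
Variables (M : riemannian R n) (T : \bar R) (X : R -> chart_index M -> 'rV[R]_n -> 'rV[R]_n).
Hypothesis M_compact : compact [set: M].
Hypothesis X_vfield : forall t, time_in T t -> is_vfield (X t).
Hypothesis X_smooth : forall i, tsmooth T (ccodom (atlas i)) (fun t y => X t i y).

Let U i := ccodom (@atlas _ _ M i).
Let oU i : open (U i). Proof. exact: ccodom_open. Qed.
Let gs i := @metric_smooth _ _ M i.
Let gsym i := @Defs.metric_sym _ _ M i.
Let gpos i := @metric_pos _ _ M i.

Let coordU i x : cdom (atlas i) x -> U i (chart_coord (atlas i) x).
Proof. by exists x. Qed.

(** The vector [w] is the image of [v] under the differential of the transition map. It is left
    existential because only the set of values over [x] matters for the maximum. *)
Lemma rayleigh_invariant t (x : M) i j v : time_in T t ->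
  cdom (atlas i) x -> cdom (atlas j) x -> v != 0 ->
  exists2 w, w != 0 & rayleigh (metric j) (X t j) (chart_coord (atlas j) x) w =
    rayleigh (metric i) (X t i) (chart_coord (atlas i) x) v.
Proof.
move=> tT ix jx v0; set y := chart_coord (atlas i) x.
pose phi := transition (atlas i) (atlas j).
pose O := chart_coord (atlas i) @` (cdom (atlas i) `&` cdom (atlas j)).
have phiE z : cdom (atlas i) z -> phi (chart_coord (atlas i) z) = chart_coord (atlas j) z.
  by move=> iz; rewrite /phi /transition chart_coordK.
have Oy : O y by exists x.
have OU : O `<=` U i by move=> _ [z [iz _] <-]; exact: coordU.
have OUj z : O z -> U j (phi z) by move=> [z' [iz jz] <-]; rewrite phiE//; exact: coordU.
have gij z : O z -> forall v w,
    ip (metric j (phi z)) ('D_v phi z) ('D_w phi z) = ip (metric i z) v w.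
  by move=> [z' [iz jz] <-] v' w'; rewrite phiE//; exact: metric_compat.
have Xij z : O z -> X t j (phi z) = 'D_(X t i z) phi z.
  by move=> [z' [iz jz] <-]; rewrite phiE//; exact: X_vfield.
have Xs k := tsmooth_smooth (@oU k) (@X_smooth k) tT.
have H := @nabla_form_invariant R n O (U i) (U j) phi (metric i) (metric j) (X t i) (X t j)
  (@overlap_open _ _ _ (atlas i) (atlas j)) (@oU i) (@oU j) OU OUj (@atlas_smooth _ _ M i j)
  (@gs i) (@gsym i) (@gpos i) (@gs j) (@gsym j) (@gpos j) (Xs i) (Xs j) gij Xij y v Oy.
have gv := gij _ Oy v v.
rewrite phiE// in H gv.
exists ('D_v phi y); last by rewrite /rayleigh H gv.
apply: contraTneq (gpos (coordU ix) v0) => D0.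
by rewrite -gv D0 /ip mul0mx mul0mx mxE ltxx.
Qed.

(** The semicontinuity hypothesis of [compact_attains_max], in one chart. The weights [a] and [b]
    serve two purposes: bounding the quotient below, and maximising the weighted comparison
    quantity. *)
Lemma rayleigh_upper_bound_near (a b : R -> R) t (x : M) i :
  {for t, continuous a} -> {for t, continuous b} ->
  time_in T t -> cdom (atlas i) x -> (exists v : 'rV[R]_n, v != 0) ->
  exists2 v : 'rV[R]_n, v != 0 &
    forall c, a t * rayleigh (metric i) (X t i) (chart_coord (atlas i) x) v + b t < c ->
    \forall q \near ((t, x) : R * M), time_in T q.1 -> cdom (atlas i) q.2 /\
      forall v, v != 0 ->
      a q.1 * rayleigh (metric i) (X q.1 i) (chart_coord (atlas i) q.2) v + b q.1 < c.
Proof.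
move=> ca cb tT ix vex.
set y := chart_coord (atlas i) x; have Uy : U i y by exact: coordU.
have [V [G [oV Vty sG fG]]] := nabla_extension (metric i) (@oU i) (@X_smooth i) tT Uy.
(* The matrix of [nabla X] rewritten through the extension [G], so that it is continuous at [(t, y)]
   even for [t = 0]. *)
pose N (z : R^o * 'rV[R]_n) : 'M[R]_n := \matrix_(k < n)
  ('D_((0 : R^o), basis_vec R k) G z + G z *m connection_mx (metric i) z.2 (basis_vec R k)).
have cN : N z @[z --> ((t : R^o), y)] --> N ((t : R^o), y).
  apply/cvg_mxP => k l; rewrite mxE.
  have -> : (fun z => N z k l) = (fun z => ('D_((0 : R^o), basis_vec R k) G z +
      G z *m connection_mx (metric i) z.2 (basis_vec R k)) 0 l).
    by apply/funext => z; rewrite mxE.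
  have cG : G z @[z --> ((t : R^o), y)] --> G ((t : R^o), y) by exact: smooth_continuous sG Vty.
  have cD : 'D_((0 : R^o), basis_vec R k) G z @[z --> ((t : R^o), y)]
      --> 'D_((0 : R^o), basis_vec R k) G ((t : R^o), y).
    exact: (smooth_continuous (smooth_derive _ sG) Vty).
  have csnd : (@snd R^o 'rV[R]_n) z @[z --> ((t : R^o), y)] --> y by exact: cvg_snd.
  have cGam : connection_mx (metric i) z (basis_vec R k) @[z --> y] --> connection_mx (metric i) y (basis_vec R k).
    exact: (smooth_continuous (connection_mx_smooth (@oU i) (@gs i) (@gpos i) _) Uy).
  have cGam2 := @cvg_comp _ _ _ (@snd R^o 'rV[R]_n)
    (fun z => connection_mx (metric i) z (basis_vec R k)) _ (nbhs y) _ csnd cGam.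
  have F2 : Filter (nbhs ((t : R^o), y)) by exact: nbhs_filter.
  exact: ((cvg_mxP F2 _ _).1 (cvgD cD (cvg_mulmx F2 cG cGam2))).
pose F := nbhs ((t, x) : R * M).
have FF : Filter F by exact: nbhs_filter.
pose phi (q : R * M) : R^o * 'rV[R]_n := (q.1, chart_coord (atlas i) q.2).
have cphi : phi q @[q --> F] --> ((t : R^o), y).
  have c1 : (@fst R M) q @[q --> F] --> t by exact: cvg_fst.
  have c2 : (@snd R M) q @[q --> F] --> x by exact: cvg_snd.
  have c3 := @cvg_comp _ _ _ (@snd R M) (chart_coord (atlas i)) _ (nbhs x) _ c2
    (@chart_coord_continuous _ _ _ (atlas i) x ix).
  exact: (cvg_pair c1 c3).
have cg : metric i (phi q).2 @[q --> F] --> metric i y.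
  have c2 : (@snd R M) q @[q --> F] --> x by exact: cvg_snd.
  have c3 := @cvg_comp _ _ _ (@snd R M) (chart_coord (atlas i)) _ (nbhs x) _ c2
    (@chart_coord_continuous _ _ _ (atlas i) x ix).
  exact: (@cvg_comp _ _ _ (fun q : R * M => chart_coord (atlas i) q.2) (metric i) _ (nbhs y) _
    c3 (smooth_continuous (@gs i) Uy)).
have cNphi := @cvg_comp _ _ _ phi N _ (nbhs ((t : R^o), y)) _ cphi cN.
have c1 : (@fst R M) q @[q --> F] --> t by exact: cvg_fst.
have caF := @cvg_comp _ _ _ (@fst R M) a _ (nbhs t) _ c1 ca.
have cbF := @cvg_comp _ _ _ (@fst R M) b _ (nbhs t) _ c1 cb.
have cS := cvg_mulmx FF cNphi cg.
have [v v0 Hv] := form_quotient_usc FF cS cg caF cbF (gpos Uy) vex.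
have RE s z : time_in T s -> U i z -> V ((s : R^o), z) -> forall w,
   rayleigh (metric i) (X s i) z w = form_quotient (N ((s : R^o), z) *m metric i z) (metric i z) w.
  move=> sT Uz Vsz w.
  have NE : nabla (metric i) (X s i) z = N ((s : R^o), z).
    have [_ E] := fG s z sT Uz Vsz; apply/row_matrixP => k.
    apply: etrans (rowE _ _) _; apply: etrans (E (basis_vec R k)) _.
    by apply: esym; exact: rowK.
  by rewrite /rayleigh /form_quotient /ip NE mulmxA.
exists v => // c; rewrite RE// => vc.
have nV : \forall q \near F, V (phi q) by apply: cphi; exact: open_nbhs_nbhs.
have nU : \forall q \near F, cdom (atlas i) q.2.
  have c2 : (@snd R M) q @[q --> F] --> x by exact: cvg_snd.
  by apply: c2; apply: open_nbhs_nbhs; split=> //; exact: cdom_open.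
have nc := Hv c vc.
apply: filterS3 nV nU nc => q Vq iq cq qT; split=> // w w0.
rewrite RE//; last exact: coordU.
exact: cq.
Qed.

Lemma rayleigh_attains_max (a b : R -> R) (t1 : R) (x0 : M) :
  continuous a -> continuous b -> 0 <= t1 -> (t1%:E < T)%E -> (exists v : 'rV[R]_n, v != 0) ->
  exists t (x : M) i (v : 'rV[R]_n), [/\ 0 <= t <= t1, cdom (atlas i) x, v != 0 &
    forall s (z : M) j (w : 'rV[R]_n), 0 <= s <= t1 -> cdom (atlas j) z -> w != 0 ->
      a s * rayleigh (metric j) (X s j) (chart_coord (atlas j) z) w + b s <=
      a t * rayleigh (metric i) (X t i) (chart_coord (atlas i) x) v + b t].
Proof.
move=> ca cb t10 t1T vex.
pose val (p : R * M) r := exists i (v : 'rV[R]_n), [/\ cdom (atlas i) p.2, v != 0 &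
  r = a p.1 * rayleigh (metric i) (X p.1 i) (chart_coord (atlas i) p.2) v + b p.1].
pose B : set (R * M) := `[0, t1]%classic `*` [set: M].
have BT p : B p -> time_in T p.1.
  move=> [/=]; rewrite in_itv/= => /andP[p0 p1] _; split=> //.
  by apply: le_lt_trans t1T; rewrite lee_fin.
have cB : compact B by apply: compact_setX => //; exact: segment_compact.
have B0 : B !=set0 by exists (0, x0); split=> //=; rewrite in_itv/= lexx.
have [p Bp|[t x] [r [Bp [i [v [ix v0 rE]]] rmax]]] := @compact_attains_max R _ B val cB B0.
  have [i ip] := atlas_cover p.2.
  have [v v0 vP] := rayleigh_upper_bound_near (ca p.1) (cb p.1) (BT _ Bp) ip vex.
  eexists; first by exists i, v; split.
  move=> c /vP; rewrite -surjective_pairing; apply: filterS => q H Bq s [j [w [jq w0 ->]]].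
  have [iq qc] := H (BT _ Bq).
  have [w' w'0 <-] := rayleigh_invariant (BT _ Bq) jq iq w0.
  exact: qc.
have [/= tB _] := Bp; rewrite in_itv/= in tB.
exists t, x, i, v; split=> // s z j w s01 jz w0.
rewrite -[leRHS]rE; apply: (rmax (s, z)); last by exists j, w.
by split=> //=; rewrite in_itv.
Qed.

End rayleigh_maximum.

(** * The Riccati inequality *)

Lemma ipDl (R : realType) (n : nat) (G : 'M[R]_n) (u v w : 'rV[R]_n) :
  ip G (u + v) w = ip G u w + ip G v w.
Proof. by rewrite /ip !mulmxDl mxE. Qed.

Lemma ipZl (R : realType) (n : nat) (G : 'M[R]_n) (c : R) (u w : 'rV[R]_n) :
  ip G (c *: u) w = c * ip G u w.
Proof. by rewrite /ip -!scalemxAl mxE. Qed.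

Lemma ip0l (R : realType) (n : nat) (G : 'M[R]_n) (w : 'rV[R]_n) : ip G 0 w = 0.
Proof. by rewrite /ip !mul0mx mxE. Qed.

Lemma is_derive_scale_arg (R : realType) (f : R -> R) (k r d : R) :
  is_derive (k * r) (1 : R) f d -> is_derive r (1 : R) (fun t => f (k * t)) (k * d).
Proof.
have E : (k * r) *: (1 : R^o) + 0 = k * r by rewrite addr0 [_ *: _]mulr1.
have eqf : (fun t : R => f ((k * t) *: (1 : R^o) + 0)) = (fun t => f (k * t)).
  by apply/funext => t; rewrite addr0 [_ *: _]mulr1.
move=> [fd <-]; rewrite -eqf -E.
by apply: (@is_derive_line_scale R R^o f 0 1 k r); rewrite E.
Qed.

Section riccati.
Context {R : realType} {n : nat}.
Variables (M : riemannian R n) (T : \bar R)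
  (X Y : R -> chart_index M -> 'rV[R]_n -> 'rV[R]_n)
  (W : R -> chart_index M -> 'rV[R]_n -> 'M[R]_n)
  (b : R -> M -> R) (k2 k3 : R).
Hypothesis M_compact : compact [set: M].
Hypothesis X_vfield : forall t, time_in T t -> is_vfield (X t).
Hypothesis X_smooth : forall i, tsmooth T (ccodom (atlas i)) (fun t y => X t i y).
Hypothesis b_ge0 : forall t x, time_in T t -> 0 <= b t x.
Hypothesis X_closed : forall t i, time_in T t ->
  dual_form_closed (metric i) (ccodom (atlas i)) (X t i).
Hypothesis W_ge : forall t (x : M) i, time_in T t -> cdom (atlas i) x ->
  let y := chart_coord (atlas i) x in
  let g := metric i in
  forall v : 'rV[R]_n,
    k3 * ip (g y) v v <=
    ip (g y) (v *m W t i y + Rm g y v (X t i y) (X t i y)) v.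
Hypothesis main_ineq : forall t (x : M) i, time_in T t -> cdom (atlas i) x ->
  let y := chart_coord (atlas i) x in
  let g := metric i in
  let nablaX := nabla g (X t i) in
  forall v : 'rV[R]_n, top_eigenvector (nablaX y) v ->
    ip (g y)
       (cov g v (fun z => dot (fun s => X s i z) t + X t i z *m nablaX z) y) v
    + k2 * ip (g y) (v *m nablaX y *m nablaX y) v
    + ip (g y) (v *m W t i y) v
    <= b t x * ip (g y) (v *m rough_laplacian g nablaX y) v
       + ip (g y) (v *m cov_endo g (Y t i y) nablaX y) v.

Lemma is_derive_rayleigh t (x : M) i v : 0 < t -> (t%:E < T)%E -> cdom (atlas i) x ->
  let y := chart_coord (atlas i) x in
  is_derive t (1 : R) (fun s => rayleigh (metric i) (X s i) y v)
    (ip (metric i y) (cov (metric i) v (fun z => dot (fun s => X s i z) t) y) v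
     / ip (metric i y) v v).
Proof.
move=> t0 tT ix y; have Uy : ccodom (atlas i) y by exists x.
have dQ := is_derive_nabla_time (metric i) (@ccodom_open _ _ _ (atlas i)) (@X_smooth i) v t0 tT Uy.
have -> : (fun s => rayleigh (metric i) (X s i) y v) =
   (fun s => (ip (metric i y) v v)^-1 *: ip (metric i y) (v *m nabla (metric i) (X s i) y) v).
  by apply/funext => s; rewrite /rayleigh mulrC.
by rewrite mulrC; exact: is_deriveZ dQ.
Qed.

Lemma riccati_at_maximum t (x : M) i v : 0 < t -> (t%:E < T)%E -> cdom (atlas i) x ->
  v != 0 ->
  (forall (z : M) w, cdom (atlas i) z -> w != 0 ->
     rayleigh (metric i) (X t i) (chart_coord (atlas i) z) w <=
     rayleigh (metric i) (X t i) (chart_coord (atlas i) x) v) ->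
  let y := chart_coord (atlas i) x in
  (ip (metric i y) (cov (metric i) v (fun z => dot (fun s => X s i z) t) y) v
     / ip (metric i y) v v <= - k3 - (1 + k2) * rayleigh (metric i) (X t i) y v ^+ 2 : Prop).
Proof.
move=> t0 tT ix v0 vmax y.
have tin : time_in T t by split; [exact: ltW|].
pose U := ccodom (atlas i); pose g := metric i; pose A := nabla g (X t i).
set lam := rayleigh _ _ _ v.
have oU : open U := @ccodom_open _ _ _ (atlas i).
have gs : smooth U g := metric_smooth i.
have gsym : forall z, U z -> (g z)^T = g z := @Defs.metric_sym _ _ M i.
have gpos : forall z, U z -> forall w, w != 0 -> 0 < ip (g z) w w := @metric_pos _ _ M i.
have Uy : U y by exists x.
have Xs : smooth U (X t i) := tsmooth_smooth oU (@X_smooth i) tin.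
have As : smooth U A := nabla_smooth oU gs gpos Xs.
have Asym : (A y *m g y)^T = A y *m g y := nabla_selfadjoint oU gs gsym gpos Xs (@X_closed t i tin) Uy.
have vv : 0 < ip (g y) v v by exact: gpos.
have Ale z w : U z -> ip (g z) (w *m A z) w <= lam * ip (g z) w w.
  move=> Uz; have [->|w0] := eqVneq w 0; first by rewrite mul0mx !ip0l mulr0.
  have wpos := gpos z Uz w w0; rewrite -ler_pdivrMr//.
  by have [z' iz <-] := Uz; apply: vmax.
have Amax : \forall z \near y, forall w, ip (g z) (w *m A z) w <= lam * ip (g z) w w.
  by apply: filterS (open_nbhs_nbhs (conj oU Uy)) => z Uz w; exact: Ale.
have Av : ip (g y) (v *m A y) v = lam * ip (g y) v v.
  by rewrite /lam /rayleigh -/y -/g -/A divfK// gt_eqF.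
have vA := maximum_eigenvector gsym gpos Uy Asym Amax Av.
(* An eigenvalue is the Rayleigh quotient of its eigenvector, hence at most [lam]. *)
have top : top_eigenvector (A y) v.
  split=> //; exists lam; split=> // mu /eigenvalueP[w wA w0].
  have := Ale y w Uy; rewrite wA ipZl ler_pM2r//; exact: gpos.
have first_order u := maximum_first_order oU gs gsym gpos As Uy Asym Amax Av u.
have lap := maximum_laplacian oU gs gsym gpos As Uy Asym Amax Av.
set d := ip _ _ v.
have d_le : d <= (- k3 - (1 + k2) * lam ^+ 2) * ip (g y) v v.
  have := main_ineq tin ix top; rewrite /= -/y -/g -/A.
  have -> : cov g v (fun z => dot (fun s => X s i z) t + X t i z *m A z) y =
      cov g v (fun z => dot (fun s => X s i z) t) y + cov g v (fun z => X t i z *m A z) y.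
    rewrite !covE mulmxDl addrACA; congr (_ + _).
    have dd : derivable (fun z => dot (fun s => X s i z) t) y v.
      exact: (dot_derivable oU (@X_smooth i) t0 tT Uy).
    have dXA : derivable (fun z => X t i z *m A z) y v.
      exact: (smooth_derivable (smooth_mulmx oU Xs As) Uy).
    by have [_ ->] := is_deriveD (derivableP dd) (derivableP dXA).
  rewrite ipDl -/d (cov_nabla_along oU gs gsym gpos v Xs Uy) -/A.
  (* Added to the main inequality, this bounds the [W] and curvature terms below together by [k3].
     The derivatives along [X] and [Y] vanish, the Laplacian term is non-positive, and the two
     squares of [nabla X] give the coefficient [1 + k2]. *)
  have := W_ge tin ix v; rewrite /= -/y -/g.
  move: (Rm g y v _ _) => rm; rewrite !ipDl !first_order vA -scalemxAl vA scalerA !ipZl !addr0.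
  have bl : b t x * ip (g y) (v *m rough_laplacian g A y) v <= 0.
    by rewrite mulr_ge0_le0// b_ge0.
  move: bl; rewrite expr2; set bL := b t x * _.
  move: (ip (g y) (v *m W t i y) v) (ip (g y) rm v) (ip (g y) v v) d bL.
  by move=> wv rmv N d0 bL; lra.
by rewrite ler_pdivrMr.
Qed.

(** The conclusion is kept in the multiplied form so that zeros of [s] are allowed: besides [t = 0],
    it must apply at [t1] when [s t1 = 0]. *)
Lemma riccati_comparison (s c : R -> R) (t1 : R) :
  0 <= t1 -> (t1%:E < T)%E ->
  (forall t : R, is_derive t (1 : R) s (c t)) ->
  (forall t : R, is_derive t (1 : R) c (- ((1 + k2) * k3) * s t)) ->
  s 0 = 0 -> c 0 = 1 -> (forall t, 0 <= t <= t1 -> 0 <= s t) -> 0 < 1 + k2 ->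
  forall t (x : M) i v, 0 <= t <= t1 -> cdom (atlas i) x -> v != 0 ->
  s t * ((1 + k2) * rayleigh (metric i) (X t i) (chart_coord (atlas i) x) v) <= c t.
Proof.
move=> t10 t1T ds dc s0 c0 sge0 k20 t x i v t01 ix v0.
have vex : exists v : 'rV[R]_n, v != 0 by exists v.
have cts (f : R -> R) df : (forall t : R, is_derive t (1 : R) f (df t)) -> continuous f.
  by move=> df' r; have [/derivable1_diffP/differentiable_continuous] := df' r.
(* The weight [- (1 + k2)] turns a maximum into a lower bound; the [+ 1] in the witness makes it
   strict. *)
have [L LP] : exists L, forall t (x : M) i v, 0 <= t <= t1 -> cdom (atlas i) x -> v != 0 ->
    - L < (1 + k2) * rayleigh (metric i) (X t i) (chart_coord (atlas i) x) v.
  have [||r [z [j [w [r01 jz w0 H]]]]] := @rayleigh_attains_max R n M T X M_compact X_vfield X_smooth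
    (fun=> - (1 + k2)) (fun=> 0) t1 x _ _ t10 t1T vex.
  - by move=> ?; exact: cst_continuous.
  - by move=> ?; exact: cst_continuous.
  exists (- (1 + k2) * rayleigh (metric j) (X r j) (chart_coord (atlas j) z) w + 1).
  move=> t' x' i' v' t'01 ix' v'0; have := H _ _ _ _ t'01 ix' v'0.
  move: (rayleigh _ _ _ _) (rayleigh _ _ _ _) => r1 r2; lra.
pose e (r : R) := expR (- L * r).
have de (r : R) : is_derive r (1 : R) e (- L * e r).
  exact: is_derive_scale_arg (is_derive_expR _).
have ce := cts _ _ de; have cs := cts _ _ ds; have cc := cts _ _ dc.
(* With these weights the maximised quantity is [exp(- L t) (s u - c)]. *)
have [||r [z [j [w [r01 jz w0 H]]]]] := @rayleigh_attains_max R n M T X M_compact X_vfield X_smooth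
    (fun r => e r * s r * (1 + k2)) (fun r => - (e r * c r)) t1 x _ _ t10 t1T vex.
- by move=> r; apply: cvgM; [apply: cvgM; [exact: ce|exact: cs]|exact: cvg_cst].
- by move=> r; apply: cvgN; apply: cvgM; [exact: ce|exact: cc].
have e0 r' : 0 < e r' by exact: expR_gt0.
pose q r' := rayleigh (metric j) (X r' j) (chart_coord (atlas j) z) w.
(* The maximum of exp(- L t) (s u - s') would have a negative time derivative. *)
suff h0 : s r * ((1 + k2) * q r) <= c r.
  have := H _ _ _ _ t01 ix v0; rewrite -/(q r).
  set Q := rayleigh _ _ _ v => H1.
  have : e t * (s t * ((1 + k2) * Q) - c t) <= e r * (s r * ((1 + k2) * q r) - c r).
    by move: H1; rewrite !mulrBr !mulrA.
  have : e r * (s r * ((1 + k2) * q r) - c r) <= 0.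
    by rewrite pmulr_rle0// subr_le0.
  by move=> /[swap] /le_trans/[apply]; rewrite pmulr_rle0// subr_le0.
rewrite leNgt; apply/negP => hpos.
have r0 : 0 < r.
  rewrite lt_neqAle eq_sym; have /andP[-> _] := r01; rewrite andbT.
  by apply/eqP => r0; move: hpos; rewrite r0 s0 c0 mul0r ltr10.
have /andP[_ rt1] := r01.
have rT : (r%:E < T)%E by apply: le_lt_trans t1T; rewrite lee_fin.
have [dq dqP dq_le] : exists2 dq, is_derive r (1 : R) q dq &
    s r * dq <= s r * (- k3 - (1 + k2) * q r ^+ 2).
  eexists; first exact: is_derive_rayleigh.
  have := sge0 r r01; rewrite le_eqVlt => /orP[/eqP <-|sr0]; first by rewrite !mul0r.
  rewrite ler_pM2l//; apply: riccati_at_maximum => // z' w' jz' w'0.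
  have := H r z' j w' r01 jz' w'0; rewrite lerD2r ler_pM2l//.
  by rewrite !mulr_gt0.
have D := is_deriveM (de r) (is_deriveB (is_deriveM (ds r) (is_deriveZ (1 + k2) dqP)) (dc r)).
have Hmax r' : 0 <= r' <= r -> (e * (s * ((1 + k2) \*: q) - c)) r' <=
    (e * (s * ((1 + k2) \*: q) - c)) r.
  move=> /andP[r'0 r'r].
  have r'1 : 0 <= r' <= t1 by rewrite r'0 (le_trans r'r).
  have := H r' z j w r'1 jz w0; rewrite -/(q r') -/(q r).
  have phiE r'' : (e * (s * ((1 + k2) \*: q) - c)) r'' =
      e r'' * s r'' * (1 + k2) * q r'' - e r'' * c r''.
    by rewrite -[LHS]/(e r'' * (s r'' * ((1 + k2) * q r'') - c r'')) mulrBr !mulrA.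
  by rewrite !phiE.
have := derive_left_max_ge0 r0 D Hmax.
have -> : (s * ((1 + k2) \*: q) - c) r = s r * ((1 + k2) * q r) - c r by [].
have -> : ((1 + k2) \*: q) r = (1 + k2) * q r by [].
have Lq := LP _ _ _ _ r01 jz w0; rewrite -/(q r) in Lq.
move: hpos Lq dq_le (sge0 _ r01) (e0 r) k20.
rewrite -subr_gt0; set h := _ - c r; rewrite -![_ *: _]/(_ * _).
move=> hpos Lq dq_le sr0 er0 kpos.
(* The time derivative at the maximum, split into the defect in the Riccati inequality, which is
   non-positive, minus a positive multiple of [h]. *)
have E : e r * (s r * ((1 + k2) * dq) + (1 + k2) * q r * c r - - ((1 + k2) * k3) * s r) +
    h * (- L * e r) =
    e r * ((1 + k2) * (s r * dq) - (1 + k2) * (s r * (- k3 - (1 + k2) * q r ^+ 2)))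
    - e r * (h * (L + (1 + k2) * q r)) by rewrite /h; ring.
rewrite E; have : e r * ((1 + k2) * (s r * dq) -
    (1 + k2) * (s r * (- k3 - (1 + k2) * q r ^+ 2))) <= 0.
  by rewrite pmulr_rle0// subr_le0 ler_pM2l.
have : 0 < e r * (h * (L + (1 + k2) * q r)).
  by rewrite mulr_gt0// mulr_gt0//; move: Lq; lra.
lra.
Qed.

End riccati.

(** * The comparison functions and the conclusion *)

Lemma is_derive_conv (R : realType) (f : R -> R) (t d d' : R) :
  is_derive t (1 : R) f d -> d = d' -> is_derive t (1 : R) f d'.
Proof. by move=> + <-. Qed.

(** The three cases are [sinh(k t) / k], [sin(k t) / k] and [t], with [k ^ 2 = |K|]. For positive
    [K] the first zero is at [pi / k]; its data are recorded because no solution can reach it. *)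
Lemma comparison_solution (R : realType) (K : R) :
  exists s c : R -> R,
  [/\ forall t : R, is_derive t (1 : R) s (c t),
      forall t : R, is_derive t (1 : R) c (- K * s t), s 0 = 0 & c 0 = 1] /\
  [/\ forall t, 0 < t -> 0 < s t -> comparison K t = c t / s t,
      K <= 0 -> forall t, 0 < t -> 0 < s t &
      0 < K -> exists2 t1, 0 < t1 &
        [/\ forall t, 0 < t < t1 -> 0 < s t, s t1 = 0 & c t1 = -1]].
Proof.
have [K0|K0|->] := ltgtP K 0.
- pose k := Num.sqrt (- K); have k0 : 0 < k by rewrite sqrtr_gt0 oppr_gt0.
  have kk : k * k = - K by rewrite -expr2 sqr_sqrtr// oppr_ge0 ltW.
  pose s t := (2 * k)^-1 * (expR (k * t) - expR (- k * t)).
  pose c t := 2^-1 * (expR (k * t) + expR (- k * t)).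
  have dE (a t : R) : is_derive t (1 : R) (fun t => expR (a * t)) (a * expR (a * t)).
    exact: is_derive_scale_arg (is_derive_expR _).
  exists s, c; split.
    split; rewrite /s /c.
    + move=> t; apply: (is_derive_conv (is_deriveZ (2 * k)^-1 (is_deriveB (dE k t) (dE (- k) t)))).
      rewrite -[LHS]/(_ * _); field; exact: lt0r_neq0.
    + move=> t; apply: (is_derive_conv (is_deriveZ 2^-1 (is_deriveD (dE k t) (dE (- k) t)))).
      rewrite -kk -[LHS]/(_ * _); field; exact: lt0r_neq0.
    + by rewrite !mulr0 subrr mulr0.
    + by rewrite !mulr0 expR0; field.
  have spos t : 0 < t -> 0 < s t.
    move=> t0; rewrite /s mulr_gt0 ?invr_gt0 ?mulr_gt0// subr_gt0 ltr_expR.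
    by rewrite ltr_pM2r// gtrN.
  split=> //.
  move=> t t0 st; rewrite /comparison ltNge (ltW K0) /= lt_eqF// /coth -/k.
  have : s t != 0 by exact: lt0r_neq0.
  rewrite /c /s !mulNr mulf_eq0 negb_or => /andP[_ h].
  by field; rewrite h lt0r_neq0.
- pose k := Num.sqrt K; have k0 : 0 < k by rewrite sqrtr_gt0.
  have kk : k * k = K by rewrite -expr2 sqr_sqrtr// ltW.
  pose s t := k^-1 * sin (k * t); pose c t := cos (k * t).
  exists s, c; split.
    split; rewrite /s /c.
    + move=> t; apply: (is_derive_conv (is_deriveZ k^-1 (is_derive_scale_arg (is_derive_sin (k * t))))).
      rewrite -[LHS]/(_ * _) mulKf//; exact: lt0r_neq0.
    + move=> t; apply: (is_derive_conv (is_derive_scale_arg (is_derive_cos (k * t)))).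
      rewrite -kk; field; exact: lt0r_neq0.
    + by rewrite mulr0 sin0 mulr0.
    + by rewrite mulr0 cos0.
  split=> //.
  + move=> t t0 st; rewrite /comparison K0 /cot -/k /c /s.
    have : s t != 0 by exact: lt0r_neq0.
    rewrite /s mulf_eq0 negb_or => /andP[_ h].
    by field; rewrite h lt0r_neq0.
  + move=> _; exists (pi / k); first by rewrite divr_gt0// pi_gt0.
    have kp : k * (pi / k) = pi by rewrite mulrC divfK// lt0r_neq0.
    rewrite /s /c kp sinpi cospi mulr0; split=> // t /andP[t0 tp].
    rewrite mulr_gt0 ?invr_gt0//; apply: sin_gt0_pi.
    by rewrite mulr_gt0//= mulrC -ltr_pdivlMr.
- exists id, (fun=> 1); split.
    split=> // t; first exact: is_derive_id.
    by rewrite oppr0 mul0r; exact: is_derive_cst.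
  split=> // t t0 _.
  by rewrite /comparison ltxx eqxx div1r.
Qed.

Unset Implicit Arguments.

Theorem theorem2p3 (R : realType) (n : nat) (M : riemannian R n)
  (M_compact : compact [set: M]) (T : \bar R)
  (X Y : R -> chart_index M -> 'rV[R]_n -> 'rV[R]_n)
  (W : R -> chart_index M -> 'rV[R]_n -> 'M[R]_n)
  (b : R -> M -> R) (k2 k3 : R)
  (X_vfield : forall t, time_in T t -> is_vfield (X t))
  (Y_vfield : forall t, time_in T t -> is_vfield (Y t))
  (W_endo : forall t, time_in T t -> is_endo (W t))
  (X_smooth : forall i, tsmooth T (ccodom (atlas i)) (fun t y => X t i y))
  (Y_smooth : forall i, tsmooth T (ccodom (atlas i)) (fun t y => Y t i y))
  (W_smooth : forall i, tsmooth T (ccodom (atlas i)) (fun t y => W t i y))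
  (b_smooth : forall i,
    tsmooth T (ccodom (atlas i)) (fun t y => b t (chart_param (atlas i) y) : R^o))
  (b_ge0 : forall t x, time_in T t -> 0 <= b t x)
  (X_closed : forall t i, time_in T t ->
    dual_form_closed (metric i) (ccodom (atlas i)) (X t i))
  (W_ge : forall t (x : M) i, time_in T t -> cdom (atlas i) x ->
    let y := chart_coord (atlas i) x in
    let g := metric i in
    forall v : 'rV[R]_n,
      k3 * ip (g y) v v <=
      ip (g y) (v *m W t i y + Rm g y v (X t i y) (X t i y)) v)
  (main_ineq : forall t (x : M) i, time_in T t -> cdom (atlas i) x ->
    let y := chart_coord (atlas i) x in
    let g := metric i in
    let nablaX := nabla g (X t i) in
    forall v : 'rV[R]_n, top_eigenvector (nablaX y) v ->
      ip (g y)
         (cov g v (fun z => dot (fun s => X s i z) t + X t i z *m nablaX z) y) v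
      + k2 * ip (g y) (v *m nablaX y *m nablaX y) v
      + ip (g y) (v *m W t i y) v
      <= b t x * ip (g y) (v *m rough_laplacian g nablaX y) v
         + ip (g y) (v *m cov_endo g (Y t i y) nablaX y) v)
  (k2_gt : 0 < 1 + k2) :
  forall t : R, 0 < t -> (t%:E < T)%E ->
  forall (x : M) i, cdom (atlas i) x ->
    let y := chart_coord (atlas i) x in
    let g := metric i in
    forall v : 'rV[R]_n,
      ip (g y) (v *m nabla g (X t i) y) v <=
      (1 + k2)^-1 * comparison ((1 + k2) * k3) t * ip (g y) v v.
Proof.
move=> t t0 tT x i ix y g v.
have [->|v0] := eqVneq v 0; first by rewrite /ip !mul0mx mxE mulr0.
have vv : 0 < ip (g y) v v by apply: metric_pos => //; exists x.
rewrite -ler_pdivrMr// -/(rayleigh g (X t i) y v) ler_pdivlMl//.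
have [s [c [[ds dc s0 c0] [cmpE snonpos spos]]]] := comparison_solution ((1 + k2) * k3).
have main t1 := @riccati_comparison R n M T X Y W b k2 k3 M_compact X_vfield X_smooth
  b_ge0 X_closed W_ge main_ineq s c t1.
(* It remains to see that [s] has no zero in [(0, t]]; past such a zero the cotangent is finite
   again but would no longer be a bound. *)
suff [st sge0] : 0 < s t /\ forall r, 0 <= r <= t -> 0 <= s r.
  rewrite cmpE// ler_pdivlMr// mulrC.
  by apply: (main t) => //; rewrite ?lexx ?andbT ltW.
have s_ge0 (t1 : R) : (forall r, 0 < r < t1 -> 0 < s r) -> 0 <= s t1 ->
    forall r, 0 <= r <= t1 -> 0 <= s r.
  move=> sp st1 r /andP[]; rewrite le_eqVlt => /orP[/eqP <-|r0]; first by rewrite s0.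
  rewrite le_eqVlt => /orP[/eqP ->//|rt1]; by rewrite ltW// sp// r0.
have [K0|K0] := leP ((1 + k2) * k3) 0.
  split; first exact: snonpos.
  by apply: s_ge0 => [r /andP[r0 _]|]; rewrite ?ltW// snonpos.
have [t1 t10 [sp st1 ct1]] := spos K0.
have [tt1|t1t] := ltP t t1.
  have st : 0 < s t by rewrite sp// t0.
  split=> //; apply: s_ge0; last exact: ltW.
  by move=> r /andP[r0 rt]; rewrite sp// r0 (lt_trans rt).
have t1T : (t1%:E < T)%E by apply: le_lt_trans tT; rewrite lee_fin.
have := main t1 (ltW t10) t1T ds dc s0 c0 (s_ge0 t1 sp _) k2_gt t1 x i v _ ix v0.
rewrite st1 ct1 lexx (ltW t10) mul0r => /(_ (lexx 0) isT).
by rewrite ler0N1.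
Qed.
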